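(* Let $(\sigma,V^{(1)},V^{(2)})$ be an isometric covariant representation of the product system $\mathbb E$ over $\mathbb N_0^2$ on a Hilbert space $\mathcal H$. Then $(\sigma_2,F^{(2)})$ is Fredholm if and only if $(\sigma,V^{(1)},V^{(2)})$ is Fredholm. Moreover (in this case), $$\operatorname{ind}(\sigma_2,F^{(2)})=\operatorname{ind}(\sigma,V^{(1)},V^{(2)}).$$
   Context: All $*$-homomorphisms and representations are nondegenerate. A $C^*$-correspondence over a $C^*$-algebra $\mathcal A$ is a Hilbert $\mathcal A$-module $F$ with a left action of $\mathcal A$ given by a $*$-homomorphism into the adjointable operators on $F$. Tensor products are interior tensor products, and for a representation $\sigma$ of $\mathcal A$ on a Hilbert space $\mathcal H$, $F\otimes\mathcal H=F\otimes_\sigma\mathcal H$ has inner product $\langle\xi_1\otimes h_1,\xi_2\otimes h_2\rangle=\langle h_1,\sigma(\langle\xi_1,\xi_2\rangle)h_2\rangle$. A (completely bounded) covariant representation of $F$ on $\mathcal H$ is a pair $(\sigma,V)$ with $\sigma:\mathcal A\to B(\mathcal H)$ a representation and $V:F\to B(\mathcal H)$ linear, completely bounded, with $V(b\xi a)=\sigma(b)V(\xi)\sigma(a)$; put $\widetilde V:F\otimes\mathcal H\to\mathcal H$, $\widetilde V(\xi\otimes h)=V(\xi)h$. It is isometric if $V(\eta)^*V(\xi)=\sigma(\langle\eta,\xi\rangle)$ (equivalently $\widetilde V$ is an isometry). A product system $\mathbb E$ over $\mathbb N_0^2$ consists of $C^*$-correspondences $E_1,E_2$ over $\mathcal A$ and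 a unitary isomorphism $t_{2,1}:E_2\otimes E_1\to E_1\otimes E_2$; $t_{1,2}=t_{2,1}^{-1}$, $E:=E_1\otimes E_2$. A covariant representation of $\mathbb E$ on $\mathcal H$ is a triple $(\sigma,V^{(1)},V^{(2)})$ where each $(\sigma,V^{(i)})$ is a covariant representation of $E_i$ and $\widetilde V^{(1)}(I_{E_1}\otimes\widetilde V^{(2)})=\widetilde V^{(2)}(I_{E_2}\otimes\widetilde V^{(1)})(t_{1,2}\otimes I_{\mathcal H})$; it is isometric if both $(\sigma,V^{(i)})$ are. Let $\mathcal W_1=\mathcal H\ominus\widetilde V^{(1)}(E_1\otimes\mathcal H)$ (which is $\sigma$-invariant). The Fringe operator $\widetilde F^{(2)}:E_2\otimes\mathcal W_1\to\mathcal W_1$ is $\widetilde F^{(2)}=P_{\mathcal W_1}\widetilde V^{(2)}|_{E_2\otimes\mathcal W_1}$, with $P_{\mathcal W_1}$ the orthogonal projection onto $\mathcal W_1$; it defines the covariant representation $(\sigma_2,F^{(2)})$ of $E_2$ on $\mathcal W_1$, where $\sigma_2=\sigma|_{\mathcal W_1}$. $R(\cdot)$ and $N(\cdot)$ denote range and kernel. A covariant representation $(\sigma,V)$ of a correspondence is Fredholm if $R(\widetilde V)$ is closed and $N(\widetilde V),N(\widetilde V^* )$ are finite-dimensional; then $\operatorname{ind}(\sigma,V)=\dim N(\widetilde V)-\dim N(\widetilde V^* )$. For a covariant representation $(\sigma,V^{(1)},V^{(2)})$ of $\mathbb E$ define $d_1:E\otimes\mathcal H\to(E_1\otimes\mathcal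 H)\oplus(E_2\otimes\mathcal H)$, $d_1(\eta)=(-(I_{E_1}\otimes\widetilde V^{(2)})\eta,\ (I_{E_2}\otimes\widetilde V^{(1)})(t_{1,2}\otimes I_{\mathcal H})\eta)$, and $d_2:(E_1\otimes\mathcal H)\oplus(E_2\otimes\mathcal H)\to\mathcal H$, $d_2(\eta_1,\eta_2)=\widetilde V^{(1)}\eta_1+\widetilde V^{(2)}\eta_2$ (so $d_2d_1=0$). The triple is (jointly) Fredholm if $d_1,d_2$ have closed range and $\dim N(d_1)+\dim[N(d_2)\ominus R(d_1)]+\dim[\mathcal H\ominus R(d_2)]<\infty$; its index is $\operatorname{ind}(\sigma,V^{(1)},V^{(2)})=-\dim N(d_1)+\dim[N(d_2)\ominus R(d_1)]-\dim[\mathcal H\ominus R(d_2)]$. *)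

(* Defs.v *)
From HB Require Import structures.
From mathcomp Require Import all_boot all_order all_algebra complex.
From mathcomp Require Import boolp classical_sets functions reals topology.
From mathcomp Require Import normedtype.
Set Implicit Arguments.
Unset Strict Implicit.
Unset Printing Implicit Defensive.
Import Order.TTheory GRing.Theory Num.Theory numFieldNormedType.Exports.
Local Open Scope classical_set_scope.
Local Open Scope complex_scope.
Local Open Scope ring_scope.

Definition lspan (K : numFieldType) (V : lmodType K) (S : set V) : set V :=
  [set x | exists n (c : 'I_n -> K) (v : 'I_n -> V),
     (forall i, S (v i)) /\ x = \sum_i c i *: v i].

Definition bounded_op (K : numFieldType) (V W : normedModType K)
    (T : V -> W) : Prop := linear T /\ continuous T.

(* C*-algebras need not be unital, so they carry a bare product instead of one
   of the (unital) ring structures. *)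
HB.mixin Record isCStarAlgebra (R : realType) A
    & CompleteNormedModule R[i] A := {
  cmul : A -> A -> A;
  cstar : A -> A;
  cmulA : associative cmul;
  cmulDl : left_distributive cmul +%R;
  cmulDr : right_distributive cmul +%R;
  cmulZl : forall (c : R[i]) a b, cmul (c *: a) b = c *: cmul a b;
  cmulZr : forall (c : R[i]) a b, cmul a (c *: b) = c *: cmul a b;
  cnormM : forall a b, `|cmul a b| <= `|a| * `|b|;
  cstarK : involutive cstar;
  cstarD : {morph cstar : a b / a + b};
  cstarZ : forall (c : R[i]) a, cstar (c *: a) = c^* *: cstar a;
  cstarM : forall a b, cstar (cmul a b) = cmul (cstar b) (cstar a);
  cstar_norm : forall a, `|cmul (cstar a) a| = `|a| ^+ 2
}.

#[short(type="cstarType")]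
HB.structure Definition CStarAlgebra (R : realType) :=
  {A of CompleteNormedModule R[i] A & isCStarAlgebra R A}.

(* Inner products, both A-valued and scalar, are linear in the second
   variable. *)
HB.mixin Record isHilbertModule (R : realType) (A : cstarType R) F
    & CompleteNormedModule R[i] F := {
  ract : F -> A -> F;
  ip : F -> F -> A;
  ractDl : forall x y a, ract (x + y) a = ract x a + ract y a;
  ractDr : forall x a b, ract x (a + b) = ract x a + ract x b;
  ractZl : forall (c : R[i]) x a, ract (c *: x) a = c *: ract x a;
  ractZr : forall (c : R[i]) x a, ract x (c *: a) = c *: ract x a;
  ractM : forall x a b, ract x (cmul a b) = ract (ract x a) b;
  ipDr : forall x y z, ip x (y + z) = ip x y + ip x z;
  ipZr : forall (c : R[i]) x y, ip x (c *: y) = c *: ip x y;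
  ip_ract : forall x y a, ip x (ract y a) = cmul (ip x y) a;
  ipC : forall x y, ip y x = cstar (ip x y);
  ip_ge0 : forall x, exists b, ip x x = cmul (cstar b) b;
  ip_norm : forall x, `|ip x x| = `|x| ^+ 2
}.

#[short(type="hilbertModType")]
HB.structure Definition HilbertModule (R : realType) (A : cstarType R) :=
  {F of CompleteNormedModule R[i] F & isHilbertModule R A F}.

(* lact_adj says that lact a is adjointable with adjoint lact a^*; this makes
   lact a linear, bounded and right A-linear. *)
HB.mixin Record isCorrespondence (R : realType) (A : cstarType R) F
    & HilbertModule R A F := {
  lact : A -> F -> F;
  lactDl : forall a b x, lact (a + b) x = lact a x + lact b x;
  lactZl : forall (c : R[i]) a x, lact (c *: a) x = c *: lact a x;
  lactM : forall a b x, lact (cmul a b) x = lact a (lact b x);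
  lact_adj : forall a x y, ip (lact a x) y = ip x (lact (cstar a) y);
  lact_nondeg : dense (lspan [set z | exists a x, z = lact a x])
}.

#[short(type="corrType")]
HB.structure Definition Correspondence (R : realType) (A : cstarType R) :=
  {F of HilbertModule R A F & isCorrespondence R A F}.

HB.mixin Record isHilbert (R : realType) H & CompleteNormedModule R[i] H := {
  hdot : H -> H -> R[i];
  hdotDr : forall x y z, hdot x (y + z) = hdot x y + hdot x z;
  hdotZr : forall (c : R[i]) x y, hdot x (c *: y) = c * hdot x y;
  hdotC : forall x y, hdot y x = (hdot x y)^*;
  hdot_norm : forall x, hdot x x = `|x| ^+ 2
}.

#[short(type="hilbertType")]
HB.structure Definition Hilbert (R : realType) :=
  {H of CompleteNormedModule R[i] H & isHilbert R H}.


Section CauchySchwarz.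
Variables (R : realType) (V : lmodType R[i]) (dot : V -> V -> R[i]).
Hypothesis dotDr : forall x y z, dot x (y + z) = dot x y + dot x z.
Hypothesis dotZr : forall (c : R[i]) x y, dot x (c *: y) = c * dot x y.
Hypothesis dotC : forall x y, dot y x = (dot x y)^*.
Hypothesis dot_ge0 : forall x, 0 <= dot x x.
Hypothesis dot_eq0 : forall x, dot x x = 0 -> x = 0.

Let dotDl x y z : dot (x + y) z = dot x z + dot y z.
Proof. by rewrite dotC dotDr rmorphD /= -!dotC. Qed.

Let dotZl (c : R[i]) x y : dot (c *: x) y = c^* * dot x y.
Proof. by rewrite dotC dotZr rmorphM /= -dotC. Qed.

Lemma cauchy_schwarz_form x y : `|dot x y| ^+ 2 <= dot x x * dot y y.
Proof.
have [y0|yN0] := eqVneq (dot y y) 0.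
  rewrite (dot_eq0 y0) -(scale0r y) dotZr mul0r normr0 expr0n /=.
  by rewrite mulr_ge0.
have yy : 0 < dot y y by rewrite lt_def yN0 dot_ge0.
have := dot_ge0 (x + (- (dot y x / dot y y)) *: y).
rewrite dotDl !dotDr !dotZl !dotZr rmorphN rmorphM /= fmorphV /= -!dotC.
rewrite [X in _ + _ + X](_ : _ = 0) ?addr0; last first.
  rewrite -mulrDr !mulNr divfK // subrr mulr0 oppr0 //.
rewrite mulNr subr_ge0 mulrAC ler_pdivrMr // => /(le_trans _); apply.
by rewrite mulrC (dotC x y) -normCK.
Qed.

Lemma ler_form_norm x y :
  sqrtC (dot (x + y) (x + y)) <= sqrtC (dot x x) + sqrtC (dot y y).
Proof.
have xy0 : 0 <= sqrtC (dot x x) + sqrtC (dot y y).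
  by rewrite addr_ge0 // sqrtC_ge0.
rewrite -(@ler_pXn2r _ 2) ?nnegrE ?sqrtC_ge0 // sqrtCK sqrrD !sqrtCK.
rewrite dotDl !dotDr addrA -(addrA (dot x x)) [leRHS]addrAC.
rewrite -[leRHS]addrA -[leLHS]addrA lerD2l [leRHS]addrC lerD2r.
rewrite (dotC x y) -sqrtCM ?nnegrE //.
have -> : dot x y + (dot x y)^* = 'Re (dot x y) *+ 2.
  by rewrite ReE -mulr_natr divfK // pnatr_eq0.
rewrite lerMn2r /=; apply: (le_trans ((leif_Re_Creal _))).
have xxyy : 0 <= dot x x * dot y y by rewrite mulr_ge0.
rewrite -(@ler_pXn2r _ 2) ?nnegrE ?sqrtC_ge0 // sqrtCK.
exact: cauchy_schwarz_form.
Qed.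
End CauchySchwarz.

Section HilbertTheory.
Variables (R : realType) (H : hilbertType R).
Implicit Types x y : H.

Lemma hdotxx_ge0 x : 0 <= hdot x x.
Proof. by rewrite hdot_norm exprn_ge0. Qed.

Lemma hdotxx_eq0 x : hdot x x = 0 -> x = 0.
Proof. by rewrite hdot_norm => /eqP; rewrite sqrf_eq0 => /eqP/normr0_eq0. Qed.

Lemma hdotr0 x : hdot x 0 = 0.
Proof. by have := hdotZr 0 x (0 : H); rewrite scale0r mul0r. Qed.

Lemma cauchy_schwarz x y : `|hdot x y| <= `|x| * `|y|.
Proof.
rewrite -(@ler_pXn2r _ 2) ?nnegrE ?mulr_ge0 // exprMn -!hdot_norm.
apply: cauchy_schwarz_form; [exact: hdotDr | exact: hdotZr | exact: hdotC |
  exact: hdotxx_ge0 | exact: hdotxx_eq0].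
Qed.

Lemma hdot_continuous x : continuous (hdot x : H -> R[i]^o).
Proof.
move=> y; apply/cvgrPdist_lt => e e0.
have x1 : 0 < `|x| + 1 by rewrite ltr_wpDl.
have ex : 0 < e / (`|x| + 1) by exact: divr_gt0.
apply/nbhs_ballP; exists (e / (`|x| + 1)) => // z; rewrite -ball_normE /= => yz.
have -> : hdot x y - hdot x z = hdot x (y - z).
  by rewrite -(scaleN1r z) hdotDr hdotZr mulN1r.
apply: (le_lt_trans (cauchy_schwarz _ _)).
apply: (@le_lt_trans _ _ ((`|x| + 1) * `|y - z|)).
  by rewrite ler_wpM2r // lerDl.
by rewrite mulrC -ltr_pdivlMr.
Qed.

End HilbertTheory.

Record closed_subspace (R : realType) (H : hilbertType R) := ClosedSubspace {
  csubset :> set H;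
  csub0 : csubset 0;
  csubD : forall x y, csubset x -> csubset y -> csubset (x + y);
  csubZ : forall (c : R[i]) x, csubset x -> csubset (c *: x);
  csub_closed : closed csubset
}.

Section ClosedSubspaces.
Variables (R : realType) (H : hilbertType R).
Implicit Types S : set H.

Lemma ortho_closed S : closed [set x | forall s, S s -> hdot s x = 0].
Proof.
have -> : [set x | forall s, S s -> hdot s x = 0] =
    \bigcap_(s in S) (hdot s @^-1` [set 0]).
  by apply/seteqP; split=> x /= h s Ss; exact: h.
apply: closed_bigI => s _; apply: (@closed_comp _ (R[i]^o : topologicalType)).
  by move=> x _; exact: hdot_continuous.
by apply: accessible_closed_set1; exact: hausdorff_accessible (@norm_hausdorff _ _).
Qed.

Lemma ortho0 S : forall s, S s -> hdot s 0 = 0.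
Proof. by move=> s _; exact: hdotr0. Qed.

Lemma orthoD S x y : (forall s, S s -> hdot s x = 0) ->
  (forall s, S s -> hdot s y = 0) -> forall s, S s -> hdot s (x + y) = 0.
Proof. by move=> xS yS s Ss; rewrite hdotDr xS // yS // addr0. Qed.

Lemma orthoZ S (c : R[i]) x : (forall s, S s -> hdot s x = 0) ->
  forall s, S s -> hdot s (c *: x) = 0.
Proof. by move=> xS s Ss; rewrite hdotZr xS // mulr0. Qed.

Definition orthocompl S : closed_subspace H :=
  @ClosedSubspace R H [set x | forall s, S s -> hdot s x = 0]
    (@ortho0 S) (@orthoD S) (@orthoZ S) (@ortho_closed S).

Lemma lspanD S x y : lspan S x -> lspan S y -> lspan S (x + y).
Proof.
move=> [n [c [v [Sv ->]]]] [m [d [w [Sw ->]]]].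
exists (n + m)%N, (fun i => match fintype.split i with inl j => c j | inr j => d j end),
  (fun i => match fintype.split i with inl j => v j | inr j => w j end); split.
  by move=> i; case: fintype.split.
rewrite big_split_ord /=; congr (_ + _); apply: eq_bigr => i _.
  by rewrite (unsplitK (inl i)).
by rewrite (unsplitK (inr i)).
Qed.

Lemma lspanZ S (a : R[i]) x : lspan S x -> lspan S (a *: x).
Proof.
move=> [n [c [v [Sv ->]]]]; exists n, (fun i => a * c i), v; split => //.
by rewrite scaler_sumr; apply: eq_bigr => i _; rewrite scalerA.
Qed.

Lemma lspan0 S : lspan S 0.
Proof. by exists 0%N, (fun=> 0), (fun=> 0); split=> [[]//|]; rewrite big_ord0. Qed.

Lemma closure_lspan0 S : closure (lspan S) 0.
Proof. by apply: subset_closure; exact: lspan0. Qed.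

Lemma closure_lspanD S x y : closure (lspan S) x -> closure (lspan S) y ->
  closure (lspan S) (x + y).
Proof.
move=> Sx Sy U Uxy.
have [[A B] /= [Ax By] AB] := @add_continuous H (x, y) _ Uxy.
have [a [Sa Aa]] := Sx _ Ax; have [b [Sb Bb]] := Sy _ By.
by exists (a + b); split; [exact: lspanD | exact: (AB (a, b))].
Qed.

Lemma closure_lspanZ S (c : R[i]) x : closure (lspan S) x ->
  closure (lspan S) (c *: x).
Proof.
move=> Sx U Ucx.
have [a [Sa Ua]] := Sx _ (@scaler_continuous _ H c x _ Ucx).
by exists (c *: a); split; [exact: lspanZ | exact: Ua].
Qed.

Definition closed_span S : closed_subspace H :=
  @ClosedSubspace R H (closure (lspan S)) (@closure_lspan0 S)
    (@closure_lspanD S) (@closure_lspanZ S) (@closed_closure H (lspan S)).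

End ClosedSubspaces.

Section SubHilbert.
Variables (R : realType) (H : hilbertType R) (U : closed_subspace H).

Definition hsub_pred : {pred H} := fun x => x \in csubset U.
Definition hsub : Type := {x : H | hsub_pred x}.

HB.instance Definition _ := SubChoice.copy hsub {x : H | hsub_pred x}.

Lemma hsub_submod_closed : submod_closed hsub_pred.
Proof.
split; first by rewrite inE; exact: csub0.
by move=> c x y; rewrite !inE => Ux Uy; apply: csubD => //; exact: csubZ.
Qed.

HB.instance Definition _ := GRing.isSubmodClosed.Build _ _ hsub_pred
  hsub_submod_closed.
HB.instance Definition _ := [SubChoice_isSubLmodule of hsub by <:].

Definition hsub_norm (x : hsub) : R[i] := `|val x|.

Lemma hsub_ler_normD x y : hsub_norm (x + y) <= hsub_norm x + hsub_norm y.
Proof. by rewrite /hsub_norm raddfD ler_normD. Qed.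

Lemma hsub_normrZ (c : R[i]) x : hsub_norm (c *: x) = `|c| * hsub_norm x.
Proof. by rewrite /hsub_norm linearZ normrZ. Qed.

Lemma hsub_normr0_eq0 x : hsub_norm x = 0 -> x = 0.
Proof. by move=> /normr0_eq0 x0; apply: val_inj; rewrite x0 raddf0. Qed.

HB.instance Definition _ := Lmodule_isNormed.Build R[i] hsub
  hsub_ler_normD hsub_normrZ hsub_normr0_eq0.

Lemma hsub_normE (x : hsub) : `|x| = `|val x|. Proof. by []. Qed.

Lemma hsub_complete (F : set_system hsub) :
  ProperFilter F -> cauchy F -> cvg F.
Proof.
move=> FF /(@cauchyP R[i]) Fc.
have /cauchy_cvg : cauchy (val @ F : set_system H).
  apply/(@cauchyP R[i]) => e e0; have [x Fx] := Fc _ e0; exists (val x).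
  by apply: (@filterS _ F _ _ _ _ Fx) => y; rewrite -!ball_normE.
move=> /cvg_ex[l Fl].
have Ul : csubset U l.
  apply: (closed_cvg _ (@csub_closed _ _ U) _ _ Fl).
  by apply: nearW => -[x /= Ux]; move: Ux; rewrite /hsub_pred inE.
have Ul' : hsub_pred l by rewrite /hsub_pred inE.
apply/cvg_ex; exists (Sub l Ul' : hsub); apply/cvg_ballP => e e0.
have /cvg_ballP/(_ e e0) := Fl.
by apply: filterS => y; rewrite -!ball_normE.
Qed.

HB.instance Definition _ := Uniform_isComplete.Build hsub hsub_complete.

Definition hsub_dot (x y : hsub) : R[i] := hdot (val x) (val y).

Lemma hsub_dotDr x y z : hsub_dot x (y + z) = hsub_dot x y + hsub_dot x z.
Proof. by rewrite /hsub_dot raddfD hdotDr. Qed.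

Lemma hsub_dotZr (c : R[i]) x y : hsub_dot x (c *: y) = c * hsub_dot x y.
Proof. by rewrite /hsub_dot linearZ hdotZr. Qed.

Lemma hsub_dotC x y : hsub_dot y x = (hsub_dot x y)^*.
Proof. exact: hdotC. Qed.

Lemma hsub_dot_norm x : hsub_dot x x = `|x| ^+ 2.
Proof. exact: hdot_norm. Qed.

HB.instance Definition _ := isHilbert.Build R hsub
  hsub_dotDr hsub_dotZr hsub_dotC hsub_dot_norm.

End SubHilbert.

Section DirectSum.
Variables (R : realType) (H K : hilbertType R).

(* The library's norm on H * K is the maximum of the norms, which is not a
   Hilbert norm; hsum carries the l^2 norm. *)
Definition hsum : Type := (H * K)%type.

HB.instance Definition _ := GRing.Lmodule.copy hsum (H * K)%type.

Definition hsum_dot (x y : hsum) : R[i] := hdot x.1 y.1 + hdot x.2 y.2.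

Lemma hsum_dotDr x y z : hsum_dot x (y + z) = hsum_dot x y + hsum_dot x z.
Proof. by rewrite /hsum_dot !hdotDr addrACA. Qed.

Lemma hsum_dotZr (c : R[i]) x y : hsum_dot x (c *: y) = c * hsum_dot x y.
Proof. by rewrite /hsum_dot !hdotZr mulrDr. Qed.

Lemma hsum_dotC x y : hsum_dot y x = (hsum_dot x y)^*.
Proof. by rewrite /hsum_dot rmorphD /= -!hdotC. Qed.

Lemma hsum_dot_ge0 x : 0 <= hsum_dot x x.
Proof. by rewrite addr_ge0 // hdotxx_ge0. Qed.

Lemma hsum_dot_eq0 x : hsum_dot x x = 0 -> x = 0.
Proof.
move=> /eqP; rewrite paddr_eq0 ?hdotxx_ge0 // => /andP[/eqP x1 /eqP x2].
by case: x x1 x2 => a b /= /hdotxx_eq0 -> /hdotxx_eq0 ->.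
Qed.

Definition hsum_norm (x : hsum) : R[i] := sqrtC (hsum_dot x x).

Lemma hsum_ler_normD x y : hsum_norm (x + y) <= hsum_norm x + hsum_norm y.
Proof.
exact: (ler_form_norm hsum_dotDr hsum_dotZr hsum_dotC hsum_dot_ge0
  hsum_dot_eq0).
Qed.

Lemma hsum_normrZ (c : R[i]) x : hsum_norm (c *: x) = `|c| * hsum_norm x.
Proof.
rewrite /hsum_norm hsum_dotZr hsum_dotC hsum_dotZr rmorphM /= -hsum_dotC.
rewrite mulrA -normCK sqrtCM ?nnegrE ?exprn_ge0 ?hsum_dot_ge0 //.
by rewrite sqrCK.
Qed.

Lemma hsum_normr0_eq0 x : hsum_norm x = 0 -> x = 0.
Proof. by move=> /eqP; rewrite sqrtC_eq0 => /eqP/hsum_dot_eq0. Qed.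

HB.instance Definition _ := Lmodule_isNormed.Build R[i] hsum
  hsum_ler_normD hsum_normrZ hsum_normr0_eq0.

Lemma hsum_normE (x : hsum) : `|x| = sqrtC (`|x.1| ^+ 2 + `|x.2| ^+ 2).
Proof. by rewrite -!hdot_norm. Qed.

Lemma ler_norm_hsum1 (x : hsum) : `|x.1| <= `|x|.
Proof.
rewrite -(@ler_pXn2r _ 2) ?nnegrE // hsum_normE sqrtCK.
by rewrite lerDl exprn_ge0.
Qed.

Lemma ler_norm_hsum2 (x : hsum) : `|x.2| <= `|x|.
Proof.
rewrite -(@ler_pXn2r _ 2) ?nnegrE // hsum_normE sqrtCK.
by rewrite lerDr exprn_ge0.
Qed.

Lemma ler_norm_hsumD (x : hsum) : `|x| <= `|x.1| + `|x.2|.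
Proof.
rewrite -(@ler_pXn2r _ 2) ?nnegrE ?addr_ge0 // hsum_normE sqrtCK sqrrD.
by rewrite addrAC lerDl mulrn_wge0 // mulr_ge0.
Qed.

Lemma hsum_complete (F : set_system hsum) :
  ProperFilter F -> cauchy F -> cvg F.
Proof.
move=> FF /(@cauchyP R[i]) Fc.
have /cauchy_cvg/cvg_ex[k Fk] : cauchy ((fun x : hsum => x.1) @ F).
  apply/(@cauchyP R[i]) => e e0; have [x Fx] := Fc _ e0; exists x.1.
  apply: (@filterS _ F _ _ _ _ Fx) => y; rewrite -!ball_normE /=.
  exact: (le_lt_trans (ler_norm_hsum1 (x - y))).
have /cauchy_cvg/cvg_ex[l Fl] : cauchy ((fun x : hsum => x.2) @ F).
  apply/(@cauchyP R[i]) => e e0; have [x Fx] := Fc _ e0; exists x.2.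
  apply: (@filterS _ F _ _ _ _ Fx) => y; rewrite -!ball_normE /=.
  exact: (le_lt_trans (ler_norm_hsum2 (x - y))).
apply/cvg_ex; exists ((k, l) : hsum); apply/cvg_ballP => e e0.
have e20 : 0 < e / 2 by rewrite divr_gt0.
have /cvg_ballP/(_ _ e20) Ek := Fk; have /cvg_ballP/(_ _ e20) El := Fl.
apply: filterS2 Ek El => y; rewrite -!ball_normE /= => k2 l2.
apply: (le_lt_trans (ler_norm_hsumD _)).
by rewrite [e]splitr; exact: ltrD.
Qed.

HB.instance Definition _ := Uniform_isComplete.Build hsum hsum_complete.

Lemma hsum_dot_norm x : hsum_dot x x = `|x| ^+ 2.
Proof. by rewrite sqrtCK. Qed.

HB.instance Definition _ := isHilbert.Build R hsum
  hsum_dotDr hsum_dotZr hsum_dotC hsum_dot_norm.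

End DirectSum.

Section Operators.
Variables (R : realType) (H K : hilbertType R).

Definition ker_op (T : H -> K) : set H := [set x | T x = 0].

Definition adjoint (T : H -> K) : K -> H :=
  xget (fun=> 0) [set S | forall x y, hdot (T x) y = hdot x (S y)].

(* The orthogonal projection onto U, with values in the Hilbert space U. *)
Definition proj (U : closed_subspace H) (x : H) : hsub U :=
  xget 0 [set w | forall u : hsub U, hdot (val u) (x - val w) = 0].

(* The bounded operator determined by its values f i on a family e with dense
   linear span; at most one exists. *)
Definition bop_ext (I : Type) (e : I -> H) (f : I -> K) : H -> K :=
  xget (fun=> 0) [set T | bounded_op T /\ forall i, T (e i) = f i].

End Operators.

Section Dimension.
Variables (R : realType) (H : hilbertType R).
Implicit Types S : set H.

(* S is a linear subspace of dimension n. *)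
Definition has_dim S (n : nat) : Prop :=
  exists f : {linear 'rV[R[i]]_n -> H}, injective f /\ range f = S.

Definition findim S : Prop := exists n, has_dim S n.

Definition dim S : nat := xget 0%N [set n | has_dim S n].

End Dimension.

Section Fredholm.
Variables (R : realType) (H K : hilbertType R).

Definition fredholm (T : H -> K) : Prop :=
  [/\ closed (range T), findim (ker_op T) & findim (ker_op (adjoint T))].

Definition fredholm_index (T : H -> K) : int :=
  (dim (ker_op T))%:Z - (dim (ker_op (adjoint T)))%:Z.

End Fredholm.

Record representation (R : realType) (A : cstarType R) (H : hilbertType R) :=
  Representation {
  rep :> A -> H -> H;
  rep_bounded : forall a, bounded_op (rep a);
  repD : forall a b h, rep (a + b) h = rep a h + rep b h;
  repZ : forall (c : R[i]) a h, rep (c *: a) h = c *: rep a h;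
  repM : forall a b h, rep (cmul a b) h = rep a (rep b h);
  rep_star : forall a h k, hdot (rep a h) k = hdot h (rep (cstar a) k);
  rep_nondeg : dense (lspan [set z | exists a h, z = rep a h])
}.

Section CompleteBoundedness.
Variables (R : realType) (A : cstarType R) (F : hilbertModType A).
Variable H : hilbertType R.

(* The norm of the matrix X in M_n(F) is at most M: X is viewed as the
   operator A^n -> F^n between Hilbert A-modules, which gives the canonical
   operator space structure of F, that is |X|^2 = |(sum_k <X k i, X k j>)_ij|
   in M_n(A). *)
Definition matrix_norm_le n (X : 'I_n -> 'I_n -> F) (M : R[i]) : Prop :=
  forall a : 'I_n -> A, let y i := \sum_j ract (X i j) (a j) in
  `|\sum_i ip (y i) (y i)| <= M ^+ 2 * `|\sum_j cmul (cstar (a j)) (a j)|.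

(* |V^(n)(X)| <= c |X| for all n and all X in M_n(F). *)
Definition completely_bounded (V : F -> H -> H) : Prop :=
  exists2 c : R[i], 0 <= c & forall n (X : 'I_n -> 'I_n -> F) (M : R[i]),
    0 <= M -> matrix_norm_le X M -> forall h : 'I_n -> H,
    \sum_i `|\sum_j V (X i j) (h j)| ^+ 2 <=
      (c * M) ^+ 2 * \sum_j `|h j| ^+ 2.

End CompleteBoundedness.

Record covariant_rep (R : realType) (A : cstarType R) (F : corrType A)
    (H : hilbertType R) (sigma : representation A H) := CovariantRep {
  crep :> F -> H -> H;
  crep_bounded : forall x, bounded_op (crep x);
  crepD : forall x y h, crep (x + y) h = crep x h + crep y h;
  crepZ : forall (c : R[i]) x h, crep (c *: x) h = c *: crep x h;
  crep_cb : completely_bounded crep;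
  crep_cov : forall b x a h,
    crep (lact b (ract x a)) h = sigma b (crep x (sigma a h))
}.

Definition isometric (R : realType) (A : cstarType R) (F : corrType A)
    (H : hilbertType R) (sigma : representation A H)
    (V : covariant_rep F sigma) : Prop :=
  forall y x h, adjoint (V y) (V x h) = sigma (ip y x) h.

(* An interior tensor product is a completion of the span of the elementary
   tensors for the inner product given on them. The formula for the inner
   product and the density of the span determine it up to a unique unitary, and
   imply that ctens and htens are biadditive, A-balanced and compatible with
   scalars and with the right action. *)
Record corr_tensor (R : realType) (A : cstarType R) (E F : corrType A) :=
  CorrTensor {
  ctspace :> corrType A;
  ctens : E -> F -> ctspace;
  ctens_ip : forall x1 y1 x2 y2,
    ip (ctens x1 y1) (ctens x2 y2) = ip y1 (lact (ip x1 x2) y2);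
  ctens_dense : dense (lspan [set z | exists x y, z = ctens x y]);
  ctens_lact : forall a x y, lact a (ctens x y) = ctens (lact a x) y
}.

Record hilbert_tensor (R : realType) (A : cstarType R) (F : hilbertModType A)
    (H : hilbertType R) (sigma : representation A H) := HilbertTensor {
  htspace :> hilbertType R;
  htens : F -> H -> htspace;
  htens_dot : forall x1 h1 x2 h2,
    hdot (htens x1 h1) (htens x2 h2) = hdot h1 (sigma (ip x1 x2) h2);
  htens_dense : dense (lspan [set z | exists x h, z = htens x h])
}.

(* The bounded operator F (x) H -> H sending htens x h to V x h. *)
Definition tilde (R : realType) (A : cstarType R) (F : corrType A)
    (H : hilbertType R) (sigma : representation A H)
    (FH : hilbert_tensor F sigma) (V : covariant_rep F sigma) : FH -> H :=
  bop_ext (fun p : F * H => htens FH p.1 p.2) (fun p => V p.1 p.2).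
Arguments tilde {R A F H sigma} FH V _ : rename.

(* t21_adj together with the two cancellation laws says that t21 is unitary,
   with inverse and adjoint t12. *)
Record product_system (R : realType) (A : cstarType R) := ProductSystem {
  E1 : corrType A;
  E2 : corrType A;
  E12 : corr_tensor E1 E2;
  E21 : corr_tensor E2 E1;
  t21 : E21 -> E12;
  t12 : E12 -> E21;
  t21K : cancel t21 t12;
  t12K : cancel t12 t21;
  t21_linear : linear t21;
  t21_adj : forall x y, ip (t21 x) y = ip x (t12 y);
  t21_lact : forall a x, t21 (lact a x) = lact a (t21 x);
  t21_ract : forall a x, t21 (ract x a) = ract (t21 x) a
}.

(* Choices of the interior tensor products by H. *)
Record tensor_spaces (R : realType) (A : cstarType R)
    (EE : product_system A) (H : hilbertType R)
    (sigma : representation A H) := TensorSpaces {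
  E1H : hilbert_tensor (E1 EE) sigma;
  E2H : hilbert_tensor (E2 EE) sigma;
  E12H : hilbert_tensor (E12 EE) sigma;
  E21H : hilbert_tensor (E21 EE) sigma
}.

Section ProductSystemRep.
Variables (R : realType) (A : cstarType R) (EE : product_system A).
Variables (H : hilbertType R) (sigma : representation A H).
Variable T : tensor_spaces EE sigma.
Variables (V1 : covariant_rep (E1 EE) sigma) (V2 : covariant_rep (E2 EE) sigma).

(* The operators I (x) V2~, I (x) V1~ and t12 (x) I_H, on the spaces
   (E1 (x) E2) (x) H and (E2 (x) E1) (x) H, which are identified with
   E1 (x) (E2 (x) H) and E2 (x) (E1 (x) H) through
   (x (x) y) (x) h = x (x) (y (x) h). *)
Definition I1V2 : E12H T -> E1H T :=
  bop_ext (fun p : E1 EE * E2 EE * H =>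
             htens (E12H T) (ctens (E12 EE) p.1.1 p.1.2) p.2)
          (fun p => htens (E1H T) p.1.1
             (tilde (E2H T) V2 (htens (E2H T) p.1.2 p.2))).

Definition I2V1 : E21H T -> E2H T :=
  bop_ext (fun p : E2 EE * E1 EE * H =>
             htens (E21H T) (ctens (E21 EE) p.1.1 p.1.2) p.2)
          (fun p => htens (E2H T) p.1.1
             (tilde (E1H T) V1 (htens (E1H T) p.1.2 p.2))).

Definition t12I : E12H T -> E21H T :=
  bop_ext (fun p : E12 EE * H => htens (E12H T) p.1 p.2)
          (fun p => htens (E21H T) (t12 p.1) p.2).

End ProductSystemRep.

Arguments I1V2 {R A EE H sigma} T V2 _ : rename.
Arguments I2V1 {R A EE H sigma} T V1 _ : rename.
Arguments t12I {R A EE H sigma} T _ : rename.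

Record system_rep (R : realType) (A : cstarType R) (EE : product_system A)
    (H : hilbertType R) (sigma : representation A H)
    (T : tensor_spaces EE sigma) := SystemRep {
  V1 : covariant_rep (E1 EE) sigma;
  V2 : covariant_rep (E2 EE) sigma;
  system_rep_comm : forall x,
    tilde (E1H T) V1 (I1V2 T V2 x) =
    tilde (E2H T) V2 (I2V1 T V1 (t12I T x))
}.

Section Fringe.
Variables (R : realType) (A : cstarType R) (EE : product_system A).
Variables (H : hilbertType R) (sigma : representation A H).
Variables (T : tensor_spaces EE sigma) (V : system_rep T).

Definition isometric_system : Prop := isometric (V1 V) /\ isometric (V2 V).

Definition W1 : closed_subspace H := orthocompl (range (tilde (E1H T) (V1 V))).

(* E2 (x) W1 as a closed subspace of E2 (x) H. *)
Definition E2W1 : closed_subspace (E2H T) :=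
  closed_span [set z | exists x w, csubset W1 w /\ z = htens (E2H T) x w].

(* The Fringe operator, which is the operator associated with the covariant
   representation (sigma_2, F2) of E2 on W1: F2 x w = fringe (x (x) w) and
   sigma_2 is the restriction of sigma to W1. *)
Definition fringe (z : hsub E2W1) : hsub W1 :=
  proj W1 (tilde (E2H T) (V2 V) (val z)).

Definition d1 (z : E12H T) : hsum (E1H T) (E2H T) :=
  (- I1V2 T (V2 V) z, I2V1 T (V1 V) (t12I T z)).

Definition d2 (z : hsum (E1H T) (E2H T)) : H :=
  tilde (E1H T) (V1 V) z.1 + tilde (E2H T) (V2 V) z.2.

Definition jointly_fredholm : Prop :=
  [/\ closed (range d1), closed (range d2), findim (ker_op d1),
      findim (ker_op d2 `&` orthocompl (range d1)) &
      findim (orthocompl (range d2))].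

Definition joint_index : int :=
  - (dim (ker_op d1))%:Z + (dim (ker_op d2 `&` orthocompl (range d1)))%:Z
  - (dim (orthocompl (range d2)))%:Z.

End Fringe.

Arguments fringe {R A EE H sigma T} V _ : rename.
Arguments d1 {R A EE H sigma T} V _ : rename.
Arguments d2 {R A EE H sigma T} V _ : rename.

(* Main.v *)
From HB Require Import structures.
Require Import Defs.
From mathcomp Require Import all_boot all_order all_algebra complex.
From mathcomp Require Import boolp classical_sets functions reals topology.
From mathcomp Require Import normedtype ring.

(** Let [T1], [T2] be the operators [V1~], [V2~], let [S1 = I (x) V2~] and
   [S2 = (I (x) V1~) (t12 (x) I)]. For an isometric representation all four are
   isometries, and the commutation relation is [T1 S1 = T2 S2]. Everything then
   happens in this commuting square. Let [W] be the orthogonal complement of the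
   range of [T1] and [P] the projection onto it. The domain [M = E2 (x) W] of
   the fringe operator [F = P T2] is the orthogonal complement of the range
   of [S2], because [E2 (x) H] is the orthogonal sum of [E2 (x) W] and
   [E2 (x) range T1] ([ortho_range_id_tensor_tilde]).

   The operator [d1 = (- S1, S2)] is the square root of 2 times an isometry: its
   kernel is 0 and its range is closed. The rest of the complex is read off [F].
   - [T2] maps the range of [S2] into the range of [T1], so [P T2 b] depends only
     on the projection of [b] onto [M]. Thus [x] is in the range of
     [d2 = T1 + T2] if and only if [P x] is in the range of [F] ([range_D2]), and
     one range is closed if and only if the other is.
   - For the same reason the orthogonal complement of the range of [d2] is the
     kernel of the adjoint of [F] ([coker_D2]).
   - The solutions of [T1 a + T2 b = 0] orthogonal to the range of [d1] are the
     pairs [(- T1^* T2 b, b)] with [b] in the kernel of [F] ([homology_D]).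
   So the three numbers in the joint index are 0 and the two dimensions in the
   index of [F].

   To get there one needs the projection theorem and adjoints of bounded
   operators, and the fact that a map between spanning families that preserves
   inner products extends to an isometry ([bop_ext_isometry]), which produces the
   four isometries. For [S1] and [S2] the family consists of the tensors
   [(x (x) y) (x) h]; it spans a dense subspace because [z (x) h] is
   continuous in [z], which rests on the boundedness of representations of
   C-star algebras ([rep_norm_le]). *)

Set Implicit Arguments.
Unset Strict Implicit.
Unset Printing Implicit Defensive.
Import Order.TTheory GRing.Theory Num.Theory numFieldNormedType.Exports.
Local Open Scope classical_set_scope.
Local Open Scope complex_scope.
Local Open Scope ring_scope.

(** * Linear maps and dense spans *)

Section LinearMaps.
Variables (K : numFieldType) (V W : lmodType K) (T : V -> W).
Hypothesis linT : linear T.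

Lemma lin0 : T 0 = 0.
Proof. by have := linT (-1) 0 0; rewrite scaler0 addr0 scaleN1r addNr. Qed.

Lemma linD x y : T (x + y) = T x + T y.
Proof. by have := linT 1 x y; rewrite !scale1r. Qed.

Lemma linZ c x : T (c *: x) = c *: T x.
Proof. by have := linT c x 0; rewrite lin0 !addr0. Qed.

Lemma linN x : T (- x) = - T x.
Proof. by rewrite -scaleN1r linZ scaleN1r. Qed.

Lemma linB x y : T (x - y) = T x - T y.
Proof. by rewrite linD linN. Qed.

End LinearMaps.

Section NormedSpaces.
Variables (K : numFieldType) (V W : normedModType K).

Lemma lin_bounded_continuous (T : V -> W) (c : K) :
  linear T -> (forall x, `|T x| <= c * `|x|) -> continuous T.
Proof.
move=> linT bT x; apply/cvgrPdist_lt => e e0.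
have c0 : 0 < `|c| + 1 by rewrite ltr_wpDl.
apply/nbhs_ballP; exists (e / (`|c| + 1)); first exact: divr_gt0.
move=> z; rewrite -ball_normE /= => xz; rewrite -linB //.
apply: (@le_lt_trans _ _ ((`|c| + 1) * `|x - z|)); last first.
  by rewrite mulrC -ltr_pdivlMr.
have cx : 0 <= c * `|x - z| by exact: le_trans (bT _).
apply: (le_trans (bT _)); rewrite -[leLHS]ger0_norm // normrM normr_id.
by rewrite ler_wpM2r // lerDl.
Qed.

Lemma closed_eq_continuous (T S : V -> W) :
  continuous T -> continuous S -> closed [set x | T x = S x].
Proof.
move=> cT cS.
have -> : [set x | T x = S x] = (fun x => T x - S x) @^-1` [set 0].
  by apply/seteqP; split=> x /=; [move=> ->; rewrite subrr | move=> /subr0_eq].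
apply: preimage_closed => [x _|].
  by apply: (@continuousB _ _ _ T S); [exact: cT|exact: cS].
by apply: accessible_closed_set1; exact: hausdorff_accessible (@norm_hausdorff _ _).
Qed.

(** How properties stable under linear combinations and limits pass from a
   spanning family to the whole space. *)
Lemma closure_lspan_ind (S P : set V) : closed P -> P 0 ->
  (forall x y, P x -> P y -> P (x + y)) ->
  (forall c x, P x -> P (c *: x)) -> S `<=` P -> closure (lspan S) `<=` P.
Proof.
move=> cP P0 PD PZ SP; rewrite (iffLR (closure_id P) cP); apply: closureS.
move=> _ [n [c [v [Sv ->]]]].
by elim/big_ind: _ => // i _; apply: PZ; exact: SP.
Qed.

Lemma closure_dense (S : set V) x : dense S -> closure S x.
Proof.
move=> dS B; rewrite nbhsE /= => -[U [oU Ux] UB].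
have [y [Uy Sy]] := dS U (ex_intro _ x Ux) oU.
by exists y; split; [exact: Sy|exact: UB].
Qed.

Lemma eq_dense_lspan (S : set V) (T T' : V -> W) : dense (lspan S) ->
  bounded_op T -> bounded_op T' -> {in S, T =1 T'} -> T = T'.
Proof.
move=> dS [lT cT] [lT' cT'] TT'; apply/funext => x.
apply: (closure_lspan_ind (S := S) (P := [set y | T y = T' y])) => /=.
- exact: closed_eq_continuous.
- by rewrite !lin0.
- by move=> y z yE zE; rewrite !linD // yE zE.
- by move=> c y yE; rewrite !linZ // yE.
- by move=> y Sy; apply: TT'; rewrite inE.
- exact: closure_dense.
Qed.

Lemma bounded_op_norm_le (T : V -> W) : bounded_op T ->
  exists2 c, 0 < c & forall x, `|T x| <= c * `|x|.
Proof.
move=> [lT cT]; have /cvgrPdist_lt/(_ 1 ltr01)/nbhs_ballP[e /= e0 eT] := cT 0.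
exists (2 / e) => [|x]; first by rewrite divr_gt0.
have [->|xN0] := eqVneq x 0; first by rewrite lin0 // !normr0 mulr0.
have x0 : 0 < `|x| by rewrite normr_gt0.
have [s s0 sE] : exists2 s, 0 < s & s * `|x| = e / 2.
  by exists (e / 2 / `|x|); rewrite ?divfK ?gt_eqF // !divr_gt0.
have := eT (s *: x); rewrite -ball_normE /= !sub0r (lin0 lT) sub0r.
rewrite !normrN (linZ lT) !normrZ gtr0_norm // sE => /(_ _)/ltW.
rewrite -ler_pdivlMl // mulr1.
have -> : s^-1 = 2 / e * `|x|.
  have [eN0 sN0] := (lt0r_neq0 e0, lt0r_neq0 s0).
  apply: (mulIf sN0); rewrite mulVf // -(mulrA _ `|x|) (mulrC `|x|) sE.
  by field.
by apply; rewrite ltr_pdivrMr // ltr_pMr // ltr1n.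
Qed.

Lemma dense_closure (S : set V) : (forall x, closure S x) -> dense S.
Proof.
move=> cS O [x Ox] oO.
by have [y [Sy Oy]] := cS x O (open_nbhs_nbhs (conj oO Ox)); exists y.
Qed.

End NormedSpaces.

Lemma bounded_op_comp (K : numFieldType) (V W X : normedModType K)
  (S : W -> X) (T : V -> W) : bounded_op S -> bounded_op T ->
  bounded_op (S \o T).
Proof.
move=> [lS cS] [lT cT]; split=> [c x y|x]; first by rewrite /= lT lS.
by apply: (continuous_comp (cT x)); exact: cS.
Qed.

Lemma le_mul_small_eq0 (K : numFieldType) (x c : K) : 0 <= x -> 0 <= c ->
  (forall e, 0 < e -> x <= c * e) -> x = 0.
Proof.
move=> x0 c0 xe; apply/eqP; apply: contraT => xN0.
have {x0}x0 : 0 < x by rewrite lt_def xN0.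
have c1 : 0 < c + 1 by rewrite ltr_wpDl.
have := xe _ (divr_gt0 x0 c1); rewrite mulrCA -[leLHS]mulr1 ler_pM2l //.
by rewrite ler_pdivlMr // mul1r lt_geF // ltrDl.
Qed.


(** * Real numbers inside the complex scalars *)

Section ComplexReals.
Variable R : realType.

(** The nonnegative elements of [R[i]] are real, so sets of them have infima. *)
Lemma inf_nonneg_complex (P : set R[i]) : P !=set0 ->
  (forall z, P z -> 0 <= z) ->
  exists2 d, (forall z, P z -> d <= z) &
    forall e, 0 < e -> exists2 z, P z & z < d + e.
Proof.
move=> [z0 Pz0] P0.
have zR (z : R[i]) : 0 <= z -> z = (complex.Re z)%:C.
  by move=> z_ge0; rewrite RRe_real // ger0_real.
pose Q : set R := [set complex.Re z | z in P].
have Q0 : has_inf Q.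
  split; first by exists (complex.Re z0), z0.
  by exists 0 => _ [z Pz <-]; rewrite -ler0c -zR // P0.
exists (inf Q)%:C => [z Pz|e e0].
  rewrite (zR z (P0 z Pz)) lecR; apply: ge_inf; first by case: Q0.
  by exists z.
have e0' := e0; rewrite (zR e (ltW e0)) ltcR in e0'.
have [_ [z Pz <-] ze] := inf_adherent e0' Q0.
exists z => //; rewrite (zR z (P0 z Pz)) (zR e (ltW e0)).
by rewrite -rmorphD /= ltcR.
Qed.

Lemma geometric_lt (e c : R[i]) : 0 < e -> 0 <= c ->
  exists n, c * 2^-1 ^+ n < e.
Proof.
move=> e0 c0.
have ec : 0 <= c / e by rewrite divr_ge0 // ltW.
have r0 : 0 <= complex.Re (c / e) by rewrite -ler0c RRe_real // ger0_real.
have := archi_boundP r0; set n := Num.bound _ => cn; exists n.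
have {}cn : c / e < n%:R.
  by rewrite -[c / e]RRe_real ?ger0_real // -(rmorph_nat (real_complex R)) ltcR.
rewrite exprVn ltr_pdivrMr ?exprn_gt0 // mulrC -ltr_pdivrMr //.
by apply: (lt_trans cn); rewrite -natrX ltr_nat ltn_expl.
Qed.

End ComplexReals.

(** * Orthogonal projections *)

Section InnerProduct.
Variables (R : realType) (H : hilbertType R).
Implicit Types x y z : H.

Lemma hdotDl x y z : hdot (x + y) z = hdot x z + hdot y z.
Proof. by rewrite hdotC hdotDr rmorphD /= -!hdotC. Qed.

Lemma hdotZl (c : R[i]) x y : hdot (c *: x) y = c^* * hdot x y.
Proof. by rewrite hdotC hdotZr rmorphM /= -hdotC. Qed.

Lemma hdot0l x : hdot 0 x = 0.
Proof. by rewrite hdotC hdotr0 rmorph0. Qed.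

Lemma hdotNr x y : hdot x (- y) = - hdot x y.
Proof. by rewrite -scaleN1r hdotZr mulN1r. Qed.

Lemma hdotNl x y : hdot (- x) y = - hdot x y.
Proof. by rewrite hdotC hdotNr rmorphN /= -hdotC. Qed.

Lemma hdotBr x y z : hdot x (y - z) = hdot x y - hdot x z.
Proof. by rewrite hdotDr hdotNr. Qed.

Lemma hdotBl x y z : hdot (x - y) z = hdot x z - hdot y z.
Proof. by rewrite hdotDl hdotNl. Qed.

Lemma hdot_inj x y : (forall z, hdot z x = hdot z y) -> x = y.
Proof.
move=> xy; apply/eqP; rewrite -subr_eq0; apply/eqP/hdotxx_eq0.
by rewrite hdotBr xy subrr.
Qed.

Lemma normr_hdot_eq x (K : hilbertType R) (y : K) :
  hdot x x = hdot y y -> `|x| = `|y|.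
Proof.
by rewrite !hdot_norm => /eqP; rewrite eqrXn2 // => /eqP.
Qed.

Lemma parallelogram x y :
  hdot (x - y) (x - y) = (hdot x x + hdot y y) *+ 2 - hdot (x + y) (x + y).
Proof.
rewrite !hdotBl !hdotBr !hdotDl !hdotDr.
set a := hdot x x; set b := hdot x y; set c := hdot y x; set d := hdot y y.
by rewrite mulr2n; ring.
Qed.

(** The minimum over [t] of the squared distance from [z] to [t *: w]
   is [hdot z z - `|hdot w z| ^+ 2 / hdot w w]. *)
Lemma near_min_ortho (d e : R[i]) w z :
  (forall t : R[i], d <= hdot (z - t *: w) (z - t *: w)) ->
  hdot z z <= d + e -> `|hdot w z| ^+ 2 <= hdot w w * e.
Proof.
move=> dmin ze.
have [w0|wN0] := eqVneq (hdot w w) 0.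
  by rewrite (hdotxx_eq0 w0) !hdot0l normr0 expr0n mul0r.
have ww : 0 < hdot w w by rewrite lt_def wN0 hdotxx_ge0.
have := dmin (hdot w z / hdot w w).
rewrite hdotBl !hdotBr !hdotZl !hdotZr rmorphM /= fmorphV /= -!hdotC.
rewrite [X in _ - X - _](_ : _ = `|hdot w z| ^+ 2 / hdot w w); last first.
  by rewrite normCK -hdotC mulrAC.
rewrite [X in _ - _ - X](_ : _ = 0); last by rewrite divfK // subrr.
rewrite subr0 => dz; rewrite mulrC -ler_pdivrMr //.
have := lerD dz ze; rewrite [hdot z z - _ + _]addrAC.
rewrite -addrA [d + _]addrC.
rewrite -subr_ge0 [X in 0 <= X](_ : _ = e - `|hdot w z| ^+ 2 / hdot w w).
  by rewrite subr_ge0.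
by ring.
Qed.

End InnerProduct.

Section Projection.
Variables (R : realType) (H : hilbertType R) (U : closed_subspace H).

Lemma csubN x : csubset U x -> csubset U (- x).
Proof. by rewrite -scaleN1r; exact: csubZ. Qed.

Lemma csubB x y : csubset U x -> csubset U y -> csubset U (x - y).
Proof. by move=> Ux Uy; apply: csubD => //; exact: csubN. Qed.

(** Points of [U] whose squared distance to [x] is nearly minimal form a
   Cauchy filter, by the parallelogram identity; its limit is the foot of the
   perpendicular. *)
Lemma orthogonal_decomposition x :
  exists2 l, csubset U l & forall u, csubset U u -> hdot u (x - l) = 0.
Proof.
pose sq u : R[i] := hdot (x - u) (x - u).
have [||d dmin dinf] := @inf_nonneg_complex R [set sq u | u in csubset U].
- by exists (sq 0), 0 => //; exact: csub0.
- by move=> _ [u _ <-]; exact: hdotxx_ge0.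
pose S (e : R) : set H := [set u | csubset U u /\ sq u < d + e%:C].
pose F := filter_from [set e : R | 0 < e] S.
have S_neq0 e : 0 < e -> S e !=set0.
  move=> e0; have [|_ [u Uu <-] ud] := dinf e%:C; first by rewrite ltcR.
  by exists u.
have FF : ProperFilter F.
  apply: filter_from_proper => //; apply: filter_from_filter.
    by exists 1; exact: ltr01.
  move=> e e' /= e0 e'0; exists (Num.min e e'); first by rewrite lt_min e0.
  move=> u [Uu ud]; split; split=> //; apply: (lt_le_trans ud).
    by rewrite lerD2l lecR ge_min lexx.
  by rewrite lerD2l lecR ge_min lexx orbT.
have realE (e : R[i]) : 0 < e -> exists2 r : R, 0 < r & e = r%:C.
  move=> e0; have e_r : e = (complex.Re e)%:C by rewrite RRe_real // gtr0_real.
  by exists (complex.Re e); rewrite // -ltcR -e_r.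
have Fc : cauchy F.
  apply/(@cauchyP R[i]) => e e0.
  have [r r0 er] : exists2 r : R, 0 < r & e ^+ 2 / 4 = r%:C.
    by apply: realE; rewrite divr_gt0 ?exprn_gt0 // ltr0n.
  have [u [Uu ud]] := S_neq0 r r0; exists u; exists r => // v [Uv vd].
  rewrite -ball_normE /= -(@ltr_pXn2r _ 2) ?nnegrE ?(ltW e0) // -hdot_norm.
  have -> : u - v = (x - v) - (x - u) by rewrite opprB [RHS]addrC addrA addrNK.
  rewrite parallelogram ltrBlDr.
  have mid : d * 4 <= hdot (x - v + (x - u)) (x - v + (x - u)).
    (* The squared distance of the midpoint, which is in [U], is at least [d]. *)
    have -> : x - v + (x - u) = 2 *: (x - 2^-1 *: (u + v)).
      rewrite scalerBr scalerA divff ?pnatr_eq0 // scale1r scaler_nat mulr2n.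
      by rewrite opprD addrACA [- v - u]addrC.
    rewrite hdotZl hdotZr mulrA conjC_nat -natrM mulrC ler_wpM2l ?ler0n //.
    by apply: dmin; exists (2^-1 *: (u + v)) => //; apply: csubZ; exact: csubD.
  apply: (@lt_le_trans _ _ (e ^+ 2 + d * 4)); last by rewrite lerD2l.
  have -> : e ^+ 2 + d * 4 = (d + r%:C + (d + r%:C)) *+ 2.
    by rewrite -er mulr2n; field.
  by rewrite ltrMn2r /=; apply: ltrD.
have [l Fl] := iffLR (cvg_ex _) (cauchy_cvg F Fc).
have Ul : csubset U l.
  rewrite (iffLR (closure_id _) (@csub_closed _ _ U)) => B /Fl[e e0 SB].
  have [u Su] := S_neq0 e e0.
  by exists u; split; [case: Su | exact: SB].
exists l => // w Uw; apply/eqP; rewrite -normr_eq0; apply/eqP.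
apply: (@le_mul_small_eq0 _ _ (`|w| + `|w|)) => // [|e e0].
  by rewrite addr_ge0.
have [r r0 er] : exists2 r : R, 0 < r & e ^+ 2 = r%:C.
  by apply: realE; rewrite exprn_gt0.
have [r' r'0 Sl] := Fl _ (nbhsx_ballx l e e0).
have rr'0 : 0 < Num.min r r' by rewrite lt_min r0.
have [u [Uu ud]] := S_neq0 _ rr'0.
have ul : `|l - u| < e.
  have := Sl u; rewrite -ball_normE; apply; split=> //.
  by apply: (lt_le_trans ud); rewrite lerD2l lecR ge_min lexx orbT.
have wu : `|hdot w (x - u)| <= `|w| * e.
  rewrite -(@ler_pXn2r _ 2) ?nnegrE //; last exact: (mulr_ge0 _ (ltW e0)).
  rewrite exprMn -hdot_norm.
  apply: (@near_min_ortho _ _ d) => [t|].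
    rewrite -addrA -opprD; apply: dmin; exists (u + t *: w) => //.
    by apply: csubD => //; exact: csubZ.
  by apply/ltW/(lt_le_trans ud); rewrite lerD2l er lecR ge_min lexx.
have -> : x - l = (x - u) - (l - u) by rewrite opprB addrA addrNK.
rewrite hdotBr mulrDl; apply: (le_trans (ler_normB _ _)); apply: lerD => //.
by apply: (le_trans (cauchy_schwarz _ _)); rewrite ler_wpM2l // ltW.
Qed.

Lemma proj_ortho x u : csubset U u -> hdot u (x - val (proj U x)) = 0.
Proof.
move=> Uu; have [l Ul lE] := orthogonal_decomposition x.
have Ul' : hsub_pred U l by rewrite /hsub_pred inE.
have Uu' : hsub_pred U u by rewrite /hsub_pred inE.
rewrite /proj; case: xgetP => [w _ wP|/(_ (Sub l Ul'))] /=.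
  exact: (wP (Sub u Uu')).
case=> v; apply: lE; have := valP v; by rewrite /hsub_pred inE.
Qed.

Lemma hsubP (w : hsub U) : csubset U (val w).
Proof. by have := valP w; rewrite /hsub_pred inE. Qed.

Lemma hsub_ex x : csubset U x -> exists w : hsub U, val w = x.
Proof.
move=> Ux; have Ux' : hsub_pred U x by rewrite /hsub_pred inE.
by exists (Sub x Ux').
Qed.

Lemma proj_uniq x (w : hsub U) :
  (forall u, csubset U u -> hdot u (x - val w) = 0) -> proj U x = w.
Proof.
move=> wP; apply: val_inj; apply/eqP; rewrite -subr_eq0; apply/eqP/hdotxx_eq0.
set p := val (proj U x); have Up : csubset U (p - val w).
  by apply: csubB; exact: hsubP.
rewrite [X in hdot _ X](_ : _ = (x - val w) - (x - p)); last first.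
  by rewrite opprB [RHS]addrC addrA addrNK.
by rewrite hdotBr wP // proj_ortho // subrr.
Qed.

Lemma proj_id (w : hsub U) : proj U (val w) = w.
Proof. by apply: proj_uniq => u _; rewrite subrr hdotr0. Qed.

Lemma proj_linear : linear (proj U).
Proof.
move=> c x y; apply: proj_uniq => u Uu; rewrite [val _]linearP.
by rewrite opprD addrACA -scalerBr hdotDr hdotZr !proj_ortho // mulr0 addr0.
Qed.

Lemma hdot_proj (w : hsub U) x : hdot w (proj U x) = hdot (val w) x.
Proof.
apply/esym/eqP; rewrite -subr_eq0 -[hdot w _]/(hdot (val w) (val _)) -hdotBr.
by rewrite proj_ortho //; exact: hsubP.
Qed.

Lemma norm_proj_le x : `|proj U x| <= `|x|.
Proof.
rewrite -(@ler_pXn2r _ 2) ?nnegrE // -!hdot_norm.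
set p := proj U x; have pr : hdot (val p) (x - val p) = 0.
  by apply: proj_ortho; exact: hsubP.
have -> : hdot x x = hdot (val p + (x - val p)) (val p + (x - val p)).
  by rewrite addrC addrNK.
move: (x - val p) pr => r pr; rewrite hdotDl !hdotDr (hdotC (val p) r) pr.
by rewrite rmorph0 addr0 add0r lerDl hdotxx_ge0.
Qed.

Lemma proj_continuous : continuous (proj U).
Proof.
apply: (lin_bounded_continuous (c := 1) proj_linear) => x.
by rewrite mul1r norm_proj_le.
Qed.

Lemma val_continuous : continuous (val : hsub U -> H).
Proof.
apply: (lin_bounded_continuous (c := 1)) => [c x y|x]; first exact: linearP.
by rewrite mul1r.
Qed.

End Projection.

(** The bipolar theorem for closed subspaces: it turns orthogonality into
   membership in a closed range. *)
Lemma ortho_ortho (R : realType) (H : hilbertType R) (U : closed_subspace H) x :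
  csubset (orthocompl (csubset (orthocompl (csubset U)))) x -> csubset U x.
Proof.
move=> /= xU; suff -> : x = val (proj U x) by exact: hsubP.
apply/eqP; rewrite -subr_eq0; apply/eqP/hdotxx_eq0.
have yU u : csubset U u -> hdot u (x - val (proj U x)) = 0 by exact: proj_ortho.
by rewrite hdotBr xU // hdotC yU ?rmorph0 ?subrr //; exact: hsubP.
Qed.

(** In the applications [V] is a tensor product and [S] the set of its
   elementary tensors. Taking an orthogonal complement for [U] makes it a tool
   for proving that inner products vanish. *)
Lemma dense_lspan_map (R : realType) (V : normedModType R[i])
    (H : hilbertType R) (U : closed_subspace H) (T : V -> H) (S : set V) :
  dense (lspan S) -> bounded_op T -> (forall s, S s -> csubset U (T s)) ->
  forall x, csubset U (T x).
Proof.
move=> dS [lT cT] SU x.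
apply: (closure_lspan_ind (S := S) (P := T @^-1` csubset U)) => /=.
- by apply: preimage_closed; [move=> y _; exact: cT|exact: csub_closed].
- by rewrite lin0 //; exact: csub0.
- by move=> y z Uy Uz; rewrite linD //; exact: csubD.
- by move=> c y Uy; rewrite linZ //; exact: csubZ.
- exact: SU.
- exact: closure_dense.
Qed.

Lemma closed_span_sub (R : realType) (H : hilbertType R) (S : set H)
    (U : closed_subspace H) :
  S `<=` csubset U -> csubset (closed_span S) `<=` csubset U.
Proof.
by move=> SU; apply: closure_lspan_ind; [exact: csub_closed|exact: csub0|
  exact: csubD|exact: csubZ|].
Qed.

Lemma closed_span_mem (R : realType) (H : hilbertType R) (S : set H) x :
  S x -> csubset (closed_span S) x.
Proof.
move=> Sx; apply: subset_closure; exists 1%N, (fun=> 1), (fun=> x); split=> //.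
by rewrite big_ord1 scale1r.
Qed.

(** * Adjoints, isometries and isometric extensions *)

Section Adjoint.
Variables (R : realType) (H K : hilbertType R).

(** The representing vector spans the orthogonal complement of the kernel. *)
Lemma riesz (phi : H -> R[i]^o) : linear phi -> continuous phi ->
  exists w, forall x, phi x = hdot w x.
Proof.
move=> lphi cphi.
have ker_closed : closed [set x | phi x = 0].
  by apply: (closed_eq_continuous cphi) => x; exact: cst_continuous.
have kerD x y : phi x = 0 -> phi y = 0 -> phi (x + y) = 0.
  by move=> x0 y0; rewrite linD // x0 y0 addr0.
have kerZ (c : R[i]) x : phi x = 0 -> phi (c *: x) = 0.
  by move=> x0; rewrite linZ // x0 scaler0.
pose N := @ClosedSubspace R H [set x | phi x = 0]
  (lin0 lphi) kerD kerZ ker_closed.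
have [phi0|/existsNP[x0 x0N]] := pselect (forall x, phi x = 0).
  by exists 0 => x; rewrite phi0 hdot0l.
pose w := x0 - val (proj N x0).
have wN x : phi x = 0 -> hdot w x = 0.
  by move=> x_0; rewrite hdotC (@proj_ortho _ _ N) ?rmorph0.
have phiw : phi w != 0.
  by rewrite linB // (hsubP (proj N x0)) subr0; exact/eqP.
have ww : hdot w w != 0.
  by apply: contra phiw => /eqP/hdotxx_eq0 ->; rewrite lin0.
exists ((phi w / hdot w w)^* *: w) => x; rewrite hdotZl conjCK.
have /wN : phi (x - (phi x / phi w) *: w) = 0.
  by rewrite linB // linZ // -[_ *: phi w]/(_ * phi w) divfK // subrr.
rewrite hdotBr hdotZr => /eqP; rewrite subr_eq0 => /eqP ->.
by field; rewrite ww phiw.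
Qed.

Lemma adjoint_hdot (T : H -> K) : bounded_op T ->
  forall x y, hdot (T x) y = hdot x (adjoint T y).
Proof.
move=> [lT cT].
have /choice[S TS] : forall y, exists w, forall x, hdot y (T x) = hdot w x.
  move=> y; apply: (@riesz (fun x => hdot y (T x))) => [c u v|x].
    by rewrite lT hdotDr hdotZr.
  by apply: (continuous_comp (cT x)); exact: hdot_continuous.
rewrite /adjoint; case: xgetP => [S' _ //|/(_ S)] /=; case=> x y.
by rewrite hdotC TS -hdotC.
Qed.

Lemma adjoint_bounded (T : H -> K) : bounded_op T -> bounded_op (adjoint T).
Proof.
move=> bT; have TE := adjoint_hdot bT.
have lT : linear (adjoint T).
  by move=> c x y; apply: hdot_inj => z; rewrite hdotDr hdotZr -!TE hdotDr hdotZr.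
split=> //; have [c c0 cT] := bounded_op_norm_le bT.
apply: (lin_bounded_continuous (c := c) lT) => y.
have [->|yN0] := eqVneq (adjoint T y) 0.
  by rewrite normr0 mulr_ge0 // ltW.
have y0 : 0 < `|adjoint T y| by rewrite normr_gt0.
rewrite -(ler_pM2l y0) -expr2 -hdot_norm -TE -[leLHS]ger0_norm; last first.
  by rewrite TE hdotxx_ge0.
apply: (le_trans (cauchy_schwarz _ _)); rewrite mulrCA mulrA.
by rewrite ler_wpM2r.
Qed.

End Adjoint.

Definition hisometry (R : realType) (H K : hilbertType R) (T : H -> K) : Prop :=
  linear T /\ forall x y, hdot (T x) (T y) = hdot x y.

Section Isometries.
Variables (R : realType) (H K : hilbertType R).

Lemma hisometry_norm (T : H -> K) x : hisometry T -> `|T x| = `|x|.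
Proof. by case=> _ T_iso; apply: normr_hdot_eq. Qed.

Lemma hisometry_bounded (T : H -> K) : hisometry T -> bounded_op T.
Proof.
move=> T_iso; have [lT _] := T_iso; split=> //.
by apply: (lin_bounded_continuous (c := 1) lT) => x; rewrite mul1r hisometry_norm.
Qed.

Lemma hisometry_inj (T : H -> K) : hisometry T -> injective T.
Proof.
move=> T_iso x y Txy; apply/eqP; rewrite -subr_eq0 -normr_eq0.
by rewrite -(hisometry_norm _ T_iso) linB ?Txy ?subrr ?normr0 //; case: T_iso.
Qed.

(** If [T^* T = c], then [y] is in the range of [T] if and only if
   [T T^* y = c y]. The scalar is 1 for isometries, 2 for the first map of the
   Koszul complex of a commuting square of isometries, and 1/2 for the
   projection of the graph of an isometry onto its domain. *)
Lemma closed_range_scaled_isometry (T : H -> K) (c : R[i]) : c != 0 ->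
  bounded_op T -> (forall x y, hdot (T x) (T y) = c * hdot x y) ->
  closed (range T).
Proof.
move=> c0 bT Tc; have [lT cT] := bT; have [lT' cT'] := adjoint_bounded bT.
have T'T x : adjoint T (T x) = c *: x.
  by apply: hdot_inj => z; rewrite -adjoint_hdot // Tc hdotZr.
have -> : range T = [set y | T (adjoint T y) = c *: y].
  apply/seteqP; split=> [_ [x _ <-] /=|y /= yE]; first by rewrite T'T linZ.
  exists (c^-1 *: adjoint T y) => //.
  by rewrite linZ // yE scalerA mulVf // scale1r.
apply: closed_eq_continuous => y; last exact: scaler_continuous.
by apply: (continuous_comp (cT' y)); exact: cT.
Qed.

Lemma hisometry_closed_range (T : H -> K) : hisometry T -> closed (range T).
Proof.
move=> T_iso; apply: (closed_range_scaled_isometry (oner_neq0 _)).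
  exact: hisometry_bounded.
by move=> x y; rewrite mul1r; case: T_iso.
Qed.

End Isometries.

Lemma range0 (R : realType) (H K : hilbertType R) (T : H -> K) :
  linear T -> range T 0.
Proof. by move=> lT; exists 0; rewrite ?lin0. Qed.

Lemma rangeD (R : realType) (H K : hilbertType R) (T : H -> K) :
  linear T -> forall x y, range T x -> range T y -> range T (x + y).
Proof. by move=> lT _ _ [x _ <-] [y _ <-]; exists (x + y); rewrite ?linD. Qed.

Lemma rangeZ (R : realType) (H K : hilbertType R) (T : H -> K) :
  linear T -> forall (c : R[i]) x, range T x -> range T (c *: x).
Proof. by move=> lT c _ [x _ <-]; exists (c *: x); rewrite ?linZ. Qed.

Definition range_subspace (R : realType) (H K : hilbertType R) (T : H -> K)
    (lT : linear T) (cT : closed (range T)) : closed_subspace K :=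
  @ClosedSubspace R K (range T) (range0 lT) (rangeD lT) (rangeZ lT) cT.

Section IsometricExtension.
Variables (R : realType) (H K : hilbertType R) (I : Type).
Variables (e : I -> H) (f : I -> K) (S : set H).
Hypothesis dS : dense (lspan S).
Hypothesis Se : S `<=` range e.
Hypothesis ef : forall i j, hdot (e i) (e j) = hdot (f i) (f j).

(** The graph of the extension is the closed span [G] of the pairs
   [(e i, f i)]. The two coordinates of its elements have the same inner
   products; thus [G] is a graph, and the first coordinate, which is an isometry
   up to a scalar, maps [G] onto a closed, hence full, subspace. *)
Lemma isometric_extension :
  exists2 T : H -> K, hisometry T & forall i, T (e i) = f i.
Proof.
pose gen i : hsum H K := (e i, f i).
pose G := closed_span (range gen).
have Ggen i : csubset G (gen i).
  apply: subset_closure; exists 1%N, (fun=> 1), (fun=> gen i); split.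
    by move=> _; exists i.
  by rewrite big_ord1 scale1r.
pose J (g : hsum H K) : hsum H K := (g.1, - g.2).
have JE g g' : hdot (J g) g' = hdot g.1 g'.1 - hdot g.2 g'.2.
  by rewrite -[LHS]/(hdot _ _ + hdot _ _) hdotNl.
have JC g g' : hdot (J g) g' = (hdot (J g') g)^*.
  by rewrite !JE rmorphB /= -!hdotC.
(* Two vectors of [G] have the same inner products in [H] and in [K] exactly
   when one is orthogonal to the reflection [J] of the other. *)
have G_ortho g : (forall i, hdot (J g) (gen i) = 0) ->
    forall g', csubset G g' -> hdot (J g) g' = 0.
  move=> gJ g' Gg'; pose O := orthocompl [set J g].
  suff : csubset O g' by apply.
  apply: (closure_lspan_ind (S := range gen)) Gg'.
  - exact: csub_closed.
  - exact: csub0.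
  - exact: csubD.
  - exact: csubZ.
  - by move=> _ [i _ <-] _ ->.
have G_iso g g' : csubset G g -> csubset G g' -> hdot g.1 g'.1 = hdot g.2 g'.2.
  move=> Gg Gg'; apply/eqP; rewrite -subr_eq0 -JE; apply/eqP.
  apply: (G_ortho g) => // i; rewrite JC G_ortho ?rmorph0 // => j.
  by rewrite JE ef subrr.
pose fst1 (g : hsub G) : H := (val g).1.
have lfst : linear fst1 by move=> c x y; rewrite /fst1 [val _]linearP.
have fst_cl : closed (range fst1).
  apply: (@closed_range_scaled_isometry _ _ _ _ 2^-1).
    by rewrite invr_eq0 pnatr_eq0.
    split=> //; apply: (lin_bounded_continuous (c := 1) lfst) => x.
    by rewrite mul1r; exact: ler_norm_hsum1.
  move=> x y.
  rewrite -[hdot x y]/(hdot (val x).1 (val y).1 + hdot (val x).2 (val y).2).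
  by rewrite -(G_iso _ _ (hsubP x) (hsubP y)) /fst1; field.
have /choice[T GT] : forall x, exists k, csubset G (x, k).
  move=> x; have : csubset (range_subspace lfst fst_cl) x.
    apply: (closure_lspan_ind (S := S)); [exact: fst_cl|exact: csub0|
      exact: csubD|exact: csubZ| |exact: closure_dense].
    move=> _ /Se[i _ <-]; have [g gE] := hsub_ex (Ggen i).
    by exists g => //; rewrite /fst1 gE.
  move=> [g _ <-]; exists (val g).2.
  by rewrite /fst1 -surjective_pairing; exact: hsubP.
have T_uniq x k : csubset G (x, k) -> T x = k.
  move=> Gxk; apply/eqP; rewrite -subr_eq0; apply/eqP/hdotxx_eq0.
  have Gk : csubset G (0, T x - k).
    by rewrite -(subrr x); exact: (csubB (GT x) Gxk).
  by rewrite -(G_iso _ _ Gk Gk) /= hdotr0.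
exists T => [|i]; last exact/T_uniq/Ggen.
split=> [c x y|x y]; last by rewrite -(G_iso _ _ (GT x) (GT y)).
by apply: T_uniq; exact: (csubD (csubZ c (GT x)) (GT y)).
Qed.

(** A bounded extension is unique, hence equal to the isometric one. *)
Lemma bop_ext_isometry :
  hisometry (bop_ext e f) /\ forall i, bop_ext e f (e i) = f i.
Proof.
have [T T_iso Te] := isometric_extension.
suff -> : bop_ext e f = T by [].
rewrite /bop_ext; case: xgetP => [T' _ [bT' T'e]|/(_ T)]; last first.
  by case; split=> //; exact: hisometry_bounded.
apply: (eq_dense_lspan dS) => //; first exact: hisometry_bounded.
by move=> x; rewrite inE => /Se[i _ <-]; rewrite T'e Te.
Qed.

End IsometricExtension.

(** * Boundedness of representations of C-star algebras *)

Section CStarAlgebras.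
Variables (R : realType) (A : cstarType R).
Implicit Types a b c d : A.

Lemma cmulBl a b c : cmul (a - b) c = cmul a c - cmul b c.
Proof. by rewrite cmulDl -scaleN1r cmulZl scaleN1r. Qed.

Lemma cmulBr a b c : cmul a (b - c) = cmul a b - cmul a c.
Proof. by rewrite cmulDr -scaleN1r cmulZr scaleN1r. Qed.

Lemma cstar0 : cstar 0 = 0 :> A.
Proof. by have := cstarZ 0 (0 : A); rewrite conjC0 !scale0r. Qed.

Lemma cstarB a b : cstar (a - b) = cstar a - cstar b.
Proof. by rewrite cstarD -scaleN1r cstarZ rmorphN rmorph1 scaleN1r. Qed.

Lemma norm_cstar_le a : `|a| <= `|cstar a|.
Proof.
have [->|aN0] := eqVneq a 0; first by rewrite normr0.
have a0 : 0 < `|a| by rewrite normr_gt0.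
by rewrite -(ler_pM2r a0) -expr2 -cstar_norm; exact: cnormM.
Qed.

Lemma norm_cstar a : `|cstar a| = `|a|.
Proof.
apply/eqP; rewrite eq_le norm_cstar_le andbT.
by have := norm_cstar_le (cstar a); rewrite cstarK.
Qed.

Lemma norm_sqr_diff a b :
  `|cmul a a - cmul b b| <= (`|a| + `|b|) * `|a - b|.
Proof.
have -> : cmul a a - cmul b b = cmul a (a - b) + cmul (a - b) b.
  by rewrite cmulBr cmulBl addrA addrNK.
rewrite mulrDl; apply: (le_trans (ler_normD _ _)); apply: lerD.
  exact: cnormM.
by rewrite mulrC; exact: cnormM.
Qed.

(** In the unitization, [1 - d] is a square root of [1 - c]. Here [d] is the
   fixed point of [d |-> (c + d ^ 2) / 2], which maps the ball of radius [1/2]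
   to itself and is [1/2]-Lipschitz there. *)
Lemma sqrt_one_minus c : cstar c = c -> `|c| <= 4^-1 ->
  exists2 d, cstar d = d & c = d + d - cmul d d.
Proof.
move=> cE c4.
pose g d : A := 2^-1 *: (c + cmul d d).
pose u n := iter n g 0.
have half0 : 0 <= 2^-1 :> R[i] by rewrite invr_ge0 ler0n.
have g_dist a b : `|g a - g b| <= 2^-1 * ((`|a| + `|b|) * `|a - b|).
  rewrite /g -scalerBr opprD addrACA subrr add0r normrZ ger0_norm //.
  by rewrite ler_wpM2l // norm_sqr_diff.
have u_half n : `|u n| <= 2^-1.
  elim: n => [|n IH]; first by rewrite normr0.
  rewrite /u iterS -/(u n) /g normrZ ger0_norm // -[leRHS]mulr1 ler_wpM2l //.
  apply: (le_trans (ler_normD _ _)).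
  apply: (@le_trans _ _ (4^-1 + 2^-1 * 2^-1)).
    by apply: lerD => //; apply: (le_trans (cnormM _ _)); rewrite ler_pM.
  rewrite -invfM -natrM -mulr2n -mulr_natr -subr_ge0.
  by rewrite [X in 0 <= X](_ : _ = 2^-1) //; field.
have u_dist n m : `|u n - u (n + m)%N| <= 2^-1 ^+ n.
  elim: n => [|n IH].
    rewrite expr0 sub0r normrN; apply: (le_trans (u_half _)).
    by rewrite invf_le1 ?ltr0n // ler1n.
  rewrite addSn exprS; apply: (le_trans (g_dist _ _)); rewrite ler_wpM2l //.
  apply: le_trans IH; rewrite -[leRHS]mul1r ler_wpM2r //.
  by apply: (le_trans (lerD (u_half _) (u_half _))); rewrite [leRHS]splitr mul1r.
have u_cauchy : cauchy (u @ \oo).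
  apply/(@cauchyP R[i]) => e e0.
  have [n ne] := geometric_lt e0 (ler01 : 0 <= (1 : R[i])).
  exists (u n); exists n => // m /= nm; rewrite -ball_normE /=.
  by rewrite -(subnKC nm); apply: (le_lt_trans (u_dist _ _)); rewrite -[ltLHS]mul1r.
have [l ul] := iffLR (cvg_ex _) (cauchy_cvg (u @ \oo) u_cauchy).
have u_near e : 0 < e -> exists n, `|l - u n| <= e /\ `|l - u n.+1| <= e.
  move=> e0; have /cvgrPdist_lt/(_ e e0)[n _ ln] := ul.
  by exists n; split; apply/ltW/ln => /=.
exists l.
  have us n : cstar (u n) = u n.
    elim: n => [|n IH]; first exact: cstar0.
    by rewrite /u iterS -/(u n) /g cstarZ cstarD cstarM cE IH fmorphV /= conjC_nat.
  apply/eqP; rewrite -subr_eq0 -normr_eq0; apply/eqP.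
  apply: (@le_mul_small_eq0 _ _ 2) => // e e0; have [n [ln _]] := u_near e e0.
  have -> : cstar l - l = cstar (l - u n) - (l - u n).
    by rewrite cstarB us opprB addrA addrNK.
  apply: (le_trans (ler_normB _ _)); rewrite norm_cstar mulr_natl mulr2n.
  exact: lerD.
suff gl : g l = l.
  by rewrite -{1 2}gl -scalerDl -[2^-1]mul1r -splitr scale1r addrK.
apply/eqP; rewrite -subr_eq0 -normr_eq0; apply/eqP.
apply: (@le_mul_small_eq0 _ _ (2^-1 * (`|l| + 2^-1) + 1)) => // [|e e0].
  by rewrite addr_ge0 // mulr_ge0 // addr_ge0.
have [n [ln lSn]] := u_near e e0.
have -> : g l - l = (g l - g (u n)) - (l - u n.+1).
  by rewrite opprB addrA addrNK.
rewrite mulrDl mul1r; apply: (le_trans (ler_normB _ _)); apply: lerD => //.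
apply: (le_trans (g_dist _ _)); rewrite -mulrA ler_wpM2l // ler_pM //.
  by rewrite addr_ge0.
by rewrite lerD2l.
Qed.

End CStarAlgebras.

Section Representations.
Variables (R : realType) (A : cstarType R) (H : hilbertType R).
Variable sigma : representation A H.
Implicit Types (a b c : A) (h k : H).

Lemma repB a b h : sigma (a - b) h = sigma a h - sigma b h.
Proof. by rewrite repD -scaleN1r repZ scaleN1r. Qed.

(** With [d] selfadjoint and [c = 2 d - d ^ 2], the difference of the two sides
   is [|h - sigma d h| ^ 2]. *)
Lemma rep_selfadjoint_le c h : cstar c = c -> `|c| <= 4^-1 ->
  hdot h (sigma c h) <= hdot h h.
Proof.
move=> cE /(sqrt_one_minus cE)[d dE ->].
rewrite -subr_ge0; have := hdotxx_ge0 (h - sigma d h).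
rewrite repB repD repM hdotBl !hdotBr hdotDr !rep_star dE => /le_trans; apply.
by rewrite le_eqVlt; apply/orP; left; apply/eqP; ring.
Qed.

(** By homogeneity one may assume [|a| = 1/2]; then [c = a^* a] has norm 1/4,
   and [|sigma a h| ^ 2 = <h, sigma c h>]. The constant is not optimal. *)
Lemma rep_norm_le a h : `|sigma a h| <= 2 * `|a| * `|h|.
Proof.
have [->|aN0] := eqVneq a 0.
  by rewrite -(scale0r (0 : A)) repZ !scale0r !normr0 mulr0 mul0r.
have a0 : 0 < `|a| by rewrite normr_gt0.
pose s := (2 * `|a|)^-1; have s0 : 0 < s by rewrite invr_gt0 mulr_gt0.
have : `|sigma (s *: a) h| <= `|h|.
  rewrite -(@ler_pXn2r _ 2) ?nnegrE // -!hdot_norm rep_star -repM.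
  apply: rep_selfadjoint_le; first by rewrite cstarM cstarK.
  rewrite cstar_norm normrZ gtr0_norm // /s invfM -mulrA mulVf ?gt_eqF // mulr1.
  by rewrite exprVn -natrX.
by rewrite repZ normrZ gtr0_norm // ler_pdivrMl // mulr_gt0.
Qed.

End Representations.

(** * Interior tensor products with a Hilbert space *)

Section HilbertTensor.
Variables (R : realType) (A : cstarType R) (F : hilbertModType A).
Variables (H : hilbertType R) (sigma : representation A H).
Variable FH : hilbert_tensor F sigma.
Implicit Types (x y : F) (h k : H) (a : A).

(** Linearity and balancedness of the elementary tensors follow from this and
   from the formula for their inner products. *)
Lemma htens_inj (v w : FH) :
  (forall x h, hdot (htens FH x h) v = hdot (htens FH x h) w) -> v = w.
Proof.
move=> vw; apply/eqP; rewrite -subr_eq0; apply/eqP/hdotxx_eq0.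
pose U := orthocompl [set v - w].
suff : csubset U (v - w) by apply.
apply: (closure_lspan_ind (S := [set z | exists x h, z = htens FH x h])).
- exact: csub_closed.
- exact: csub0.
- exact: csubD.
- exact: csubZ.
- move=> _ [x [h ->]] _ ->; rewrite hdotC hdotBr vw subrr ?rmorph0 //.
- by apply: closure_dense; exact: htens_dense.
Qed.

Lemma htens_linearl h : linear (fun x => htens FH x h).
Proof.
move=> c x y; apply: htens_inj => z k.
by rewrite hdotDr hdotZr !htens_dot ipDr ipZr repD repZ hdotDr hdotZr.
Qed.

Lemma htens_linearr x : linear (htens FH x).
Proof.
move=> c h k; apply: htens_inj => z l; have [lin _] := rep_bounded sigma (ip z x).
by rewrite hdotDr hdotZr !htens_dot lin hdotDr hdotZr.
Qed.

Lemma htens_ract x a h : htens FH (ract x a) h = htens FH x (sigma a h).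
Proof. by apply: htens_inj => z l; rewrite !htens_dot ip_ract repM. Qed.

(** This is where the boundedness of [sigma] enters. *)
Lemma htens_norm_le x h : `|htens FH x h| <= 2 * `|x| * `|h|.
Proof.
rewrite -(@ler_pXn2r _ 2) ?nnegrE ?mulr_ge0 // -hdot_norm htens_dot.
rewrite -[leLHS]ger0_norm; last by rewrite -(htens_dot FH) hdotxx_ge0.
apply: (le_trans (cauchy_schwarz _ _)).
apply: (le_trans (ler_wpM2l (normr_ge0 _) (rep_norm_le _ _ _))).
rewrite ip_norm [leLHS](_ : _ = 2 * (`|x| * `|h|) ^+ 2); last by ring.
rewrite [leRHS](_ : _ = 4 * (`|x| * `|h|) ^+ 2); last by ring.
by rewrite ler_wpM2r ?exprn_ge0 ?mulr_ge0 // ler_nat.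
Qed.

Lemma htens_boundedl h : bounded_op (fun x => htens FH x h).
Proof.
split; first exact: htens_linearl.
apply: (lin_bounded_continuous (c := 2 * `|h|) (htens_linearl h)) => x.
by rewrite mulrAC htens_norm_le.
Qed.

Lemma htens_boundedr x : bounded_op (htens FH x).
Proof.
split; first exact: htens_linearr.
apply: (lin_bounded_continuous (c := 2 * `|x|) (htens_linearr x)) => h.
exact: htens_norm_le.
Qed.

End HilbertTensor.

(** * Isometric covariant representations *)

Section Correspondences.
Variables (R : realType) (A : cstarType R) (F : corrType A).
Implicit Types (x y : F) (a b : A).

Lemma ip_inj x y : (forall z, ip z x = ip z y) -> x = y.
Proof.
move=> xy; apply/eqP; rewrite -subr_eq0 -normr_eq0 -(@sqrf_eq0 R[i]) -ip_norm.
by rewrite -scaleN1r ipDr ipZr xy !scaleN1r subrr normr0.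
Qed.

Lemma lact_ract b x a : lact b (ract x a) = ract (lact b x) a.
Proof.
apply: ip_inj => z; rewrite -[b]cstarK -lact_adj !ip_ract.
by rewrite -lact_adj.
Qed.

End Correspondences.

Section IsometricRepresentation.
Variables (R : realType) (A : cstarType R) (F : corrType A).
Variables (H : hilbertType R) (sigma : representation A H).
Variables (FH : hilbert_tensor F sigma) (V : covariant_rep F sigma).
Hypothesis isoV : isometric V.
Implicit Types (x y : F) (h k : H) (a b : A).

Lemma isometric_hdot x y h k : hdot (V x h) (V y k) = hdot h (sigma (ip x y) k).
Proof. by rewrite -isoV -adjoint_hdot //; exact: crep_bounded. Qed.

(** That [V] is isometric says that the vectors [V x h] have the same inner
   products as the tensors [x (x) h]. *)
Lemma tilde_spec : hisometry (tilde FH V) /\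
  forall x h, tilde FH V (htens FH x h) = V x h.
Proof.
have [||iso val] := @bop_ext_isometry _ _ _ _
  (fun p : F * H => htens FH p.1 p.2) (fun p => V p.1 p.2)
  _ (@htens_dense _ _ _ _ _ FH).
- by move=> _ [x [h ->]]; exists (x, h).
- by move=> p q; rewrite htens_dot isometric_hdot.
by split=> // x h; exact: (val (x, h)).
Qed.

Lemma crep_ract x a h : V (ract x a) h = V x (sigma a h).
Proof. by have [_ val] := tilde_spec; rewrite -val htens_ract val. Qed.

(** The covariance condition gives this on the vectors [sigma a h], whose span
   is dense since [sigma] is nondegenerate. *)
Lemma crep_lact b x h : V (lact b x) h = sigma b (V x h).
Proof.
suff -> : V (lact b x) = sigma b \o V x by [].
apply: (eq_dense_lspan (rep_nondeg sigma)).
- exact: crep_bounded.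
- by apply: bounded_op_comp; [exact: rep_bounded | exact: crep_bounded].
move=> z; rewrite inE => -[a [k ->]] /=.
by rewrite -crep_ract -lact_ract crep_cov.
Qed.

End IsometricRepresentation.

(** * Iterated tensor products *)

Section IteratedTensor.
Variables (R : realType) (A : cstarType R) (E F : corrType A).
Variables (EF : corr_tensor E F) (H : hilbertType R).
Variable sigma : representation A H.
Variables (EH : hilbert_tensor E sigma) (FH : hilbert_tensor F sigma).
Variables (EFH : hilbert_tensor EF sigma) (V : covariant_rep F sigma).
Hypothesis isoV : isometric V.

(** A tensor [w (x) h] with [w] in [E (x) F] depends continuously on [w], which
   is a limit of sums of elementary tensors. *)
Lemma htens_ctens_dense :
  dense (lspan (range (fun p : E * F * H =>
    htens EFH (ctens EF p.1.1 p.1.2) p.2))).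
Proof.
set S := range _; apply: dense_closure.
have eS : forall z, csubset (closed_span S) z; last exact: eS.
have id_bounded : bounded_op (@idfun EFH) by split=> // x; exact: cvg_id.
apply: (dense_lspan_map (@htens_dense _ _ _ _ _ EFH) id_bounded).
move=> _ [w [h ->]]; move: w; apply: (dense_lspan_map (U := closed_span S)
  (@ctens_dense _ _ _ _ EF) (htens_boundedl EFH h)).
by move=> _ [x [y ->]]; apply: closed_span_mem; exists (x, y, h).
Qed.

(** This is the operator [I (x) V~] between [(E (x) F) (x) H] and [E (x) H]. *)
Definition id_tensor_tilde : EFH -> EH :=
  bop_ext (fun p : E * F * H => htens EFH (ctens EF p.1.1 p.1.2) p.2)
          (fun p => htens EH p.1.1 (tilde FH V (htens FH p.1.2 p.2))).

Lemma id_tensor_tilde_spec : hisometry id_tensor_tilde /\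
  forall x y h,
    id_tensor_tilde (htens EFH (ctens EF x y) h) = htens EH x (V y h).
Proof.
have [_ Vval] := tilde_spec FH isoV.
have [||iso val] := @bop_ext_isometry _ _ _ _
  (fun p : E * F * H => htens EFH (ctens EF p.1.1 p.1.2) p.2)
  (fun p => htens EH p.1.1 (tilde FH V (htens FH p.1.2 p.2)))
  _ htens_ctens_dense.
- by [].
- move=> [[x y] h] [[x' y'] h'] /=; rewrite !htens_dot ctens_ip !Vval.
  by rewrite -(crep_lact FH isoV) isometric_hdot.
by split=> // x y h; rewrite -Vval; exact: (val (x, y, h)).
Qed.

(** As [E (x) H] is the sum of [E (x) range V~] and [E (x) W], it remains to see
   that these are orthogonal; this is the invariance of [W] under [sigma]. *)
Lemma ortho_range_id_tensor_tilde :
  csubset (orthocompl (range id_tensor_tilde)) =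
  csubset (closed_span [set z | exists x w,
    csubset (orthocompl (range (tilde FH V))) w /\ z = htens EH x w]).
Proof.
have [V_iso Vval] := tilde_spec FH isoV; have [lV _] := V_iso.
have [iso T_val] := id_tensor_tilde_spec; have [lT cT] := hisometry_bounded iso.
set W := orthocompl (range (tilde FH V)); set S := [set z | _].
set U := closed_span S.
have htens_U x w : csubset W w -> csubset U (htens EH x w).
  by move=> Ww; apply: closed_span_mem; exists x, w.
have W_inv a w : csubset W w -> csubset W (sigma a w).
  move=> Ww _ [z _ <-].
  suff aw : csubset (orthocompl [set sigma a w]) (tilde FH V z).
    by rewrite hdotC aw ?rmorph0.
  move: z; apply: (dense_lspan_map (@htens_dense _ _ _ _ _ FH)).
    exact: hisometry_bounded.
  move=> _ [x [h ->]] _ ->.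
  by rewrite rep_star Vval -(crep_lact FH isoV) -Vval hdotC Ww ?rmorph0.
have U_ortho : csubset U `<=` csubset (orthocompl (range id_tensor_tilde)).
  apply: closed_span_sub => _ [x [w [Ww ->]]] _ [v _ <-].
  suff vw : csubset (orthocompl [set htens EH x w]) (id_tensor_tilde v).
    by rewrite hdotC vw ?rmorph0.
  move: v; apply: (dense_lspan_map htens_ctens_dense).
    exact: hisometry_bounded.
  move=> _ [[[y f] h] _ <-] _ -> /=.
  by rewrite T_val htens_dot -Vval hdotC rep_star W_inv ?rmorph0.
apply/seteqP; split=> [z zT|]; last exact: U_ortho.
suff -> : z = val (proj U z) by exact: hsubP.
set p := val (proj U z).
have pU u : csubset U u -> hdot u (z - p) = 0 by exact: proj_ortho.
have pT u : hdot (id_tensor_tilde u) (z - p) = 0.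
  have zpT := csubB zT (U_ortho _ (hsubP (proj U z))).
  by apply: zpT; exists u.
apply: htens_inj => x h; apply/eqP; rewrite -subr_eq0 -hdotBr; apply/eqP.
have cV := hisometry_closed_range V_iso.
pose V_range := range_subspace lV cV.
(* Split [h] along the range of [V~] and its orthogonal complement [W]. *)
have -> : h = val (proj V_range h) + (h - val (proj V_range h)).
  by rewrite addrC addrNK.
have [lx cx] := htens_boundedr EH x.
rewrite (linD lx) hdotDl [X in _ + X]pU ?addr0; last first.
  by apply: htens_U => v Vv; exact: proj_ortho.
have [y _ <-] := hsubP (proj V_range h).
suff zy : csubset (orthocompl [set z - p]) (htens EH x (tilde FH V y)).
  by rewrite hdotC zy ?rmorph0.
move: y; apply: (dense_lspan_map (@htens_dense _ _ _ _ _ FH)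
  (bounded_op_comp (htens_boundedr EH x) (hisometry_bounded V_iso))).
by move=> _ [u [k ->]] _ -> /=; rewrite Vval -T_val hdotC pT rmorph0.
Qed.

End IteratedTensor.

(** * Dimensions *)

Lemma has_dim_linear (R : realType) (H : hilbertType R) (S : set H) n
    (f : 'rV[R[i]]_n -> H) :
  linear f -> injective f -> range f = S -> has_dim S n.
Proof.
move=> lf f_inj fS.
pose g : {linear 'rV[R[i]]_n -> H} :=
  HB.pack f (GRing.isLinear.Build R[i] _ H *:%R f lf).
by exists g.
Qed.

Lemma has_dim_image (R : realType) (H K : hilbertType R) (phi : H -> K)
    (S : set H) n :
  linear phi -> injective phi -> has_dim (phi @` S) n <-> has_dim S n.
Proof.
move=> lphi phi_inj; split=> [[f [f_inj fS]]|[f [f_inj fS]]]; last first.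
  apply: (@has_dim_linear _ _ _ _ (phi \o f)).
  - by move=> c x y; rewrite /= linearP lphi.
  - by move=> x y /phi_inj/f_inj.
  - by rewrite -fS image_comp.
have /choice[g gP] : forall v, exists x, S x /\ phi x = f v.
  move=> v; have : (phi @` S) (f v) by rewrite -fS; exists v.
  by move=> [x Sx xE]; exists x.
have gE v : phi (g v) = f v by case: (gP v).
apply: (@has_dim_linear _ _ _ _ g).
- by move=> c x y; apply: phi_inj; rewrite lphi !gE linearP.
- by move=> x y /(congr1 phi); rewrite !gE => /f_inj.
apply/seteqP; split=> [_ [v _ <-]|x Sx]; first by case: (gP v).
have : range f (phi x) by rewrite fS; exists x.
by move=> [v _ vx]; exists v => //; apply: phi_inj; rewrite gE.
Qed.

Lemma findim_image (R : realType) (H K : hilbertType R) (phi : H -> K)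
    (S : set H) :
  linear phi -> injective phi -> findim (phi @` S) <-> findim S.
Proof.
move=> lphi phi_inj.
by split=> -[n Sn]; exists n; apply/(has_dim_image S n lphi phi_inj).
Qed.

(** [dim] selects an element of the set of possible dimensions, and this set is
   the same for both subspaces. *)
Lemma dim_image (R : realType) (H K : hilbertType R) (phi : H -> K)
    (S : set H) :
  linear phi -> injective phi -> Defs.dim (phi @` S) = Defs.dim S.
Proof.
move=> lphi phi_inj; rewrite /Defs.dim; congr (xget _ _).
by apply/funext => n; apply/propext; exact: has_dim_image.
Qed.

Lemma has_dim_set0 (R : realType) (H : hilbertType R) : has_dim [set 0 : H] 0.
Proof.
apply: (@has_dim_linear _ _ _ _ (fun=> 0)).
- by move=> c x y; rewrite scaler0 addr0.
- by move=> x y _; rewrite !thinmx0.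
- by apply/seteqP; split=> [_ [v _ <-]//|x ->]; exists 0.
Qed.

Lemma dim_set0 (R : realType) (H : hilbertType R) : Defs.dim [set 0 : H] = 0%N.
Proof.
rewrite /Defs.dim; case: xgetP => [n _ [f [f_inj f0]]|/(_ 0%N)]; last first.
  by case; exact: has_dim_set0.
case: n f f_inj f0 => // n f f_inj f0.
have fv0 v : f v = 0.
  by have : range f (f v); [exists v | rewrite f0].
have /f_inj/rowP/(_ ord0) : f (const_mx 1) = f 0 by rewrite !fv0.
by rewrite !mxE => /eqP; rewrite oner_eq0.
Qed.

(** * Commuting squares of isometries *)

(** The whole argument only involves four isometries with [T1 S1 = T2 S2]. The
   maps [D1] and [D2] form the Koszul complex of the square, and [F] is the
   compression of [T2] to the complements [M] and [W] of the ranges of [S2]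
   and [T1]. *)
Section CommutingIsometries.
Variables (R : realType) (K0 K1 K2 H : hilbertType R).
Variables (T1 : K1 -> H) (T2 : K2 -> H) (S1 : K0 -> K1) (S2 : K0 -> K2).
Hypotheses (T1_iso : hisometry T1) (T2_iso : hisometry T2).
Hypotheses (S1_iso : hisometry S1) (S2_iso : hisometry S2).
Hypothesis comm : forall z, T1 (S1 z) = T2 (S2 z).
Variable M : closed_subspace K2.
Hypothesis M_ortho : csubset M = csubset (orthocompl (range S2)).

Let W := orthocompl (range T1).
Let F (z : hsub M) : hsub W := proj W (T2 (val z)).
Let D1 (z : K0) : hsum K1 K2 := (- S1 z, S2 z).
Let D2 (z : hsum K1 K2) : H := T1 z.1 + T2 z.2.

Let lT1 : linear T1. Proof. by case: T1_iso. Qed.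
Let lT2 : linear T2. Proof. by case: T2_iso. Qed.
Let lS1 : linear S1. Proof. by case: S1_iso. Qed.
Let lS2 : linear S2. Proof. by case: S2_iso. Qed.
Let bT1 : bounded_op T1. Proof. exact: hisometry_bounded. Qed.

Let proj_W_T1 a : proj W (T1 a) = 0.
Proof.
apply: proj_uniq => u Wu; rewrite subr0 hdotC Wu ?rmorph0 //.
Qed.

Let proj_W_eq0 x : proj W x = 0 -> range T1 x.
Proof.
move=> x0; have cT1 := hisometry_closed_range T1_iso.
apply: (@ortho_ortho _ _ (range_subspace lT1 cT1)) => u Wu.
by have := proj_ortho x Wu; rewrite x0 subr0.
Qed.

Let D1_linear : linear D1.
Proof. by move=> c x y; rewrite /D1 lS1 lS2 opprD -scalerN. Qed.

Let D1_dot x y : hdot (D1 x) (D1 y) = 2 * hdot x y.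
Proof.
rewrite -[LHS]/(hdot (- S1 x) (- S1 y) + hdot (S2 x) (S2 y)).
rewrite hdotNl hdotNr opprK; case: S1_iso => _ ->; case: S2_iso => _ ->.
by ring.
Qed.

Lemma closed_range_D1 : closed (range D1).
Proof.
have two_neq0 : 2 != 0 :> R[i] by rewrite pnatr_eq0.
apply: (closed_range_scaled_isometry two_neq0) D1_dot.
split; first exact: D1_linear.
apply: (lin_bounded_continuous (c := 2) D1_linear) => x.
rewrite -(@ler_pXn2r _ 2) ?nnegrE ?mulr_ge0 // -hdot_norm D1_dot exprMn.
by rewrite hdot_norm ler_wpM2r ?exprn_ge0 // -natrX ler_nat.
Qed.

Lemma ker_D1 : ker_op D1 = [set 0].
Proof.
apply/seteqP; split=> [z /(congr1 snd) /= z0|_ ->] /=; last exact: lin0.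
by apply: (hisometry_inj S2_iso); rewrite z0 lin0.
Qed.

(** The part of [b] orthogonal to [M] lies in the range of [S2], and [T2] maps
   it into the range of [T1]. *)
Let fringe_proj b : F (proj M b) = proj W (T2 b).
Proof.
have cS2 := hisometry_closed_range S2_iso.
have [c _ cE] : range S2 (b - val (proj M b)).
  apply: (@ortho_ortho _ _ (range_subspace lS2 cS2)) => u Su.
  by apply: proj_ortho; rewrite M_ortho.
have bE : b = val (proj M b) + S2 c by rewrite cE addrC addrNK.
by rewrite [in RHS]bE (linD lT2) (linD (proj_linear W)) -comm proj_W_T1 addr0.
Qed.

Let F_linear : linear F.
Proof. by move=> c x y; rewrite /F [val _]linearP lT2 proj_linear. Qed.

Let F_bounded : bounded_op F.
Proof.
split=> //; apply: (lin_bounded_continuous (c := 1) F_linear) => z.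
by rewrite mul1r; apply: (le_trans (norm_proj_le _ _)); rewrite hisometry_norm.
Qed.

(** The projection onto [W] removes [T1 a] from [T1 a + T2 b], and its kernel is
   the range of [T1]. *)
Lemma range_D2 : range D2 = proj W @^-1` range F.
Proof.
have lW := proj_linear W.
apply/seteqP; split=> [_ [z _ <-]|x [z _ zE]] /=.
  exists (proj M z.2) => //.
  by rewrite fringe_proj (linD lW) proj_W_T1 add0r.
have [a _ aE] : range T1 (x - T2 (val z)).
  by apply: proj_W_eq0; rewrite (linB lW) -zE subrr.
by exists (a, val z) => //; rewrite /D2 /= aE addrNK.
Qed.

Lemma range_fringe : range F = val @^-1` range D2.
Proof.
rewrite range_D2 -comp_preimage; apply/esym/seteqP.
by split=> w; rewrite /preimage /= proj_id.
Qed.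

Lemma closed_range_D2 : closed (range F) <-> closed (range D2).
Proof.
split=> cl; [rewrite range_D2|rewrite range_fringe].
  by apply: preimage_closed => // x _; exact: proj_continuous.
by apply: preimage_closed => // x _; exact: val_continuous.
Qed.

(** A vector orthogonal to the range of [D2] is a [w] in [W] orthogonal to the
   range of [T2], and [<T2 b, w> = <F p, w>] for the projection [p] of [b]
   onto [M]. *)
Lemma coker_D2 :
  csubset (orthocompl (range D2)) = val @` ker_op (adjoint F).
Proof.
apply/seteqP; split=> [x xD|_ [w wF <-] _ [z _ <-]].
  have [w wx] : exists w : hsub W, val w = x.
    apply: hsub_ex => _ [a _ <-]; apply: xD; exists (a, 0) => //.
    by rewrite /D2 /= lin0 // addr0.
  exists w => //; apply: hdot_inj => z; rewrite hdotr0 -adjoint_hdot //.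
  rewrite hdotC hdot_proj wx -hdotC; apply: xD; exists (0, val z) => //.
  by rewrite /D2 /= lin0 // add0r.
rewrite /D2 hdotDl (hsubP w) ?add0r; last by exists z.1.
by rewrite hdotC -hdot_proj -fringe_proj -hdotC adjoint_hdot // wF hdotr0.
Qed.

(** [T2] maps a vector [z] of the kernel of [F] into the range of [T1], so
   [T1 a + T2 z = 0] for [a = - T1^* T2 z]. *)
Let phi (z : hsub M) : hsum K1 K2 := (- adjoint T1 (T2 (val z)), val z).

Let T1'T1 a : adjoint T1 (T1 a) = a.
Proof.
by apply: hdot_inj => u; rewrite -adjoint_hdot //; case: T1_iso.
Qed.

Let phi_linear : linear phi.
Proof.
have [lT1' _] := adjoint_bounded bT1.
by move=> c x y; rewrite /phi [val _]linearP lT2 lT1' opprD -scalerN.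
Qed.

Let phi_inj : injective phi.
Proof. by move=> x y /(congr1 snd) /= /val_inj. Qed.

(** If [T1 a + T2 b = 0], then [<S1 c, a> = <T1 S1 c, T1 a> = - <T2 S2 c, T2 b> =
   - <S2 c, b>], so [(a, b)] is orthogonal to [D1 c = (- S1 c, S2 c)] if and only
   if [b] is orthogonal to [S2 c]. Hence [b] is in [M], and [F b = 0]. *)
Lemma homology_D :
  ker_op D2 `&` csubset (orthocompl (range D1)) = phi @` ker_op F.
Proof.
have [[_ dT1] [_ dT2]] := (T1_iso, T2_iso).
have dotE c a b : hdot (D1 c) ((a, b) : hsum K1 K2) =
    - hdot (S1 c) a + hdot (S2 c) b.
  by rewrite -[LHS]/(hdot _ _ + hdot _ _) hdotNl.
apply/seteqP; split=> [[a b] [/= ab0 abD]|_ [z Fz <-]].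
  have T1a : T1 a = - T2 b.
    by apply/eqP; rewrite -addr_eq0; exact/eqP.
  have [z zb] : exists z : hsub M, val z = b.
    apply: hsub_ex; rewrite M_ortho => _ [c _ <-].
    have := abD (D1 c) (imageT _ _); rewrite dotE -dT1 T1a comm hdotNr dT2 opprK.
    by rewrite -mulr2n => /eqP; rewrite mulrn_eq0 => /eqP.
  exists z.
    rewrite /ker_op /= /F zb -[T2 b]opprK -T1a (linN (proj_linear W)) proj_W_T1.
    by rewrite oppr0.
  rewrite /phi zb -[T2 b]opprK -T1a (linN (adjoint_bounded bT1).1) T1'T1.
  by rewrite opprK.
have [a _ aE] := proj_W_eq0 Fz.
split=> [|_ [c _ <-]]; rewrite /phi -aE T1'T1.
  by rewrite /ker_op /= /D2 /= (linN lT1) aE addNr.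
rewrite dotE hdotNr opprK -dT1 aE comm dT2.
have zM := hsubP z; rewrite M_ortho in zM.
by rewrite zM ?addr0.
Qed.

Lemma fredholm_koszul_iff :
  fredholm F <-> [/\ closed (range D1), closed (range D2), findim (ker_op D1),
      findim (ker_op D2 `&` csubset (orthocompl (range D1))) &
      findim (csubset (orthocompl (range D2)))].
Proof.
rewrite homology_D coker_D2 ker_D1; split=> [[cF kF cokF]|[_ cD2 _ hD cokD]].
  split; [exact: closed_range_D1|exact/closed_range_D2| | |].
  - by exists 0%N; exact: has_dim_set0.
  - exact/findim_image.
  - by apply/findim_image.
split; first exact/closed_range_D2.
  exact/(findim_image _ phi_linear phi_inj).
have val_linear : linear (val : hsub W -> H) by move=> c x y; exact: linearP.
exact/(findim_image _ val_linear val_inj).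
Qed.

Lemma fredholm_index_koszul :
  fredholm_index F = - (Defs.dim (ker_op D1))%:Z +
    (Defs.dim (ker_op D2 `&` csubset (orthocompl (range D1))))%:Z -
    (Defs.dim (csubset (orthocompl (range D2))))%:Z.
Proof.
rewrite homology_D coker_D2 ker_D1 dim_set0 oppr0 add0r.
have val_linear : linear (val : hsub W -> H) by move=> c x y; exact: linearP.
by rewrite (dim_image _ phi_linear phi_inj) (dim_image _ val_linear val_inj).
Qed.

End CommutingIsometries.

(** * The fringe operator *)

Section Fringe.
Variables (R : realType) (A : cstarType R) (EE : product_system A).
Variables (H : hilbertType R) (sigma : representation A H).
Variables (T : tensor_spaces EE sigma) (V : system_rep T).
Hypothesis isoV : isometric_system V.

(** The range is closed and contains [t12 (t21 w) (x) h = w (x) h]. *)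
Lemma t12I_spec : hisometry (t12I T) /\ range (t12I T) = setT.
Proof.
have [||iso val] := @bop_ext_isometry _ _ _ _
  (fun p : E12 EE * H => htens (E12H T) p.1 p.2)
  (fun p => htens (E21H T) (t12 p.1) p.2) _ (@htens_dense _ _ _ _ _ (E12H T)).
- by move=> _ [x [h ->]]; exists (x, h).
- by move=> p q; rewrite !htens_dot -t21_adj t12K.
split=> //; apply/seteqP; split=> // v _.
have cT := hisometry_closed_range iso; case: (iso) => lT _.
have id_bounded : bounded_op (@idfun (E21H T)) by split=> // x; exact: cvg_id.
suff : csubset (range_subspace lT cT) (idfun v) by [].
move: v; apply: (dense_lspan_map (@htens_dense _ _ _ _ _ (E21H T)) id_bounded).
move=> _ [w [h ->]]; exists (htens (E12H T) (t21 w) h) => //.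
by rewrite /= (val (t21 w, h)) /= t21K.
Qed.

(** As [t12 (x) I] is onto, its composition with [I (x) V1~] has the
   range of [I (x) V1~]. *)
Lemma E2W1_ortho :
  csubset (E2W1 V) = csubset (orthocompl (range (I2V1 T (V1 V) \o t12I T))).
Proof.
have [_ t_onto] := t12I_spec.
rewrite -(image_comp (t12I T) (I2V1 T (V1 V))) t_onto; apply/esym.
exact: (ortho_range_id_tensor_tilde (E2H T) (E1H T) (E21H T) isoV.1).
Qed.

End Fringe.

Unset Implicit Arguments.
Theorem theorem5p4 (R : realType) (A : cstarType R) (EE : product_system A)
    (H : hilbertType R) (sigma : representation A H)
    (T : tensor_spaces EE sigma) (V : system_rep T)
    (isoV : isometric_system V) :
  (fredholm (fringe V) <-> jointly_fredholm V) /\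
  (fredholm (fringe V) -> fredholm_index (fringe V) = joint_index V).
Proof.
have [iso1 iso2] := isoV; have [t_iso _] := t12I_spec T.
have [T1_iso _] := tilde_spec (E1H T) iso1.
have [T2_iso _] := tilde_spec (E2H T) iso2.
have [S1_iso _] : hisometry (I1V2 T (V2 V)) /\ _ :=
  id_tensor_tilde_spec (E1H T) (E2H T) (E12H T) iso2.
have [I2V1_iso _] : hisometry (I2V1 T (V1 V)) /\ _ :=
  id_tensor_tilde_spec (E2H T) (E1H T) (E21H T) iso1.
have S2_iso : hisometry (I2V1 T (V1 V) \o t12I T).
  have [[lS dS] [lt dt]] := (I2V1_iso, t_iso).
  by split=> [c x y|x y] /=; [rewrite lt lS|rewrite dS dt].
split.
  exact: (fredholm_koszul_iff T1_iso T2_iso S1_iso S2_iso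
    (system_rep_comm V) (E2W1_ortho isoV)).
move=> _; exact: (fredholm_index_koszul T1_iso T2_iso S1_iso S2_iso
    (system_rep_comm V) (E2W1_ortho isoV)).
Qed.
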